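(* Let $n\ge 1$ and let $\Psi$ be a toric plurisubharmonic function on the unit polydisc $\mathbb D^n\subset\mathbb C^n$ with isolated singularities at $0\in\mathbb D^n$. Assume that $c_0(\Psi)=1$. Let $P\subset\mathbb R^n_{\ge 0}$ be the Newton convex body of $\Psi$ (then $(1,\dots,1)\in\partial P$). The following are equivalent: (1) The Ohsawa norm of $\Psi$ is not singular at the origin $0\in\mathbb D^n$. (2) The boundary of $P$ is locally a hyperplane near the point $(1,\dots,1)\in\partial P$; that is, there exists an open ball $B$ centered at $(1,\dots,1)$ such that $$\{x\in B:\ \alpha_1(x_1-1)+\dots+\alpha_n(x_n-1)\ge 0\}=P\cap B$$ for some $\alpha_j\ge 0$, $1\le j\le n$, with $\alpha_1+\dots+\alpha_n=1$.
   Context: A plurisubharmonic (psh) function $\Psi$ on $\mathbb D^n$ is toric if $\Psi(z_1,\dots,z_n)=\Psi(|z_1|,\dots,|z_n|)$ for all $z\in\mathbb D^n$. Then there is a convex function $g$ on $(-\infty,0)^n$, increasing in each variable, with $\Psi(z)=g(\log|z_1|^2,\dots,\log|z_n|^2)$. ''Isolated singularities at $0$'' means that $\Psi$ is locally bounded on $\mathbb D^n\setminus\{0\}$. A Newton convex body is a closed convex subset $P$ of $[0,\infty)^n$ with $P+[0,\infty)^n=P$. $P$ is the Newton convex body of $\Psi$ if the associated convex function $g$ satisfies $\sup_{x\in(-\infty,0)^n}|g(x)-h_P(x)|<\infty$, where $h_P(x):=\sup_{\alpha\in P}\alpha\cdot x$. The log canonical threshold is $c_0(\Psi):=\sup\{c\ge0: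 e^{-c\Psi}\text{ is integrable near }0\}$. Ohsawa norm: for a continuous nonnegative $(n,n)$-form $g$ on an open set $U\subset\mathbb D^n$, put $$\|g\|_\Psi:=\sup_{K\text{ compact in }U}\ \limsup_{t\to-\infty}\int_{\{t<\Psi<t+1\}\cap K} g\,e^{-\Psi}.$$ The Ohsawa norm of $\Psi$ is singular at a point $p$ if $\|g\|_\Psi=\infty$ for every continuous nonnegative $(n,n)$-form $g$ defined near $p$ with $g(p)\neq 0$. *)

(* Defs.v *)
From HB Require Import structures.
From mathcomp Require Import all_boot all_order all_algebra.
From mathcomp Require Import complex.
From mathcomp Require Import all_classical all_reals all_analysis.

Set Implicit Arguments.
Unset Strict Implicit.
Unset Printing Implicit Defensive.

Import Order.TTheory GRing.Theory Num.Theory.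
Import numFieldTopology.Exports numFieldNormedType.Exports.

Local Open Scope classical_set_scope.
Local Open Scope ring_scope.

(* The metric topology of the complex field R[i]; row vectors over R[i] then
   get the product topology. *)
#[warnings="-redundant-canonical-projection"]
HB.instance Definition _ (R : realType) :=
  PseudoPointedMetric.copy R[i] R[i]^o.

(* MathComp-Analysis has binary product measures only: [power_measure mu n] is
   the n-fold product measure on n.-tuple T, built by adding one factor at a
   time at the head of the tuple. *)
Section power_measure.
Context {d : measure_display} {T : measurableType d} {R : realType}.

Definition tuple_cons n (p : T * n.-tuple T) : n.+1.-tuple T :=
  [the n.+1.-tuple T of p.1 :: p.2].

Lemma measurable_tuple_cons n : measurable_fun [set: T * n.-tuple T]
  (@tuple_cons n).
Proof. exact: measurable_cons. Qed.

Let tail n (t : n.+1.-tuple T) : n.-tuple T := [tuple of behead t].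

Let consK n x (t : n.-tuple T) : tail (tuple_cons (x, t)) = t.
Proof. exact: val_inj. Qed.

Section step.
Variables (mu : {sigma_finite_measure set T -> \bar R}) (n : nat).
Variable nu : {sigma_finite_measure set (n.-tuple T) -> \bar R}.

Definition cons_measure : set (n.+1.-tuple T) -> \bar R :=
  pushforward (mu \x nu)%E (@tuple_cons n).

Let mcons := @measurable_tuple_cons n.

Let cons_measure0 : cons_measure set0 = 0%E.
Proof. by rewrite /cons_measure /pushforward preimage_set0 measure0. Qed.

Let cons_measure_ge0 A : (0 <= cons_measure A)%E.
Proof. exact: measure_ge0. Qed.

Let cons_measure_sigma_additive : semi_sigma_additive cons_measure.
Proof.
exact: (@measure_semi_sigma_additive _ _ _
  (measure_function_pushforward__canonical__measure_function_Measure
    (mu \x nu)%E mcons)).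
Qed.

HB.instance Definition _ := isMeasure.Build _ _ _ cons_measure
  cons_measure0 cons_measure_ge0 cons_measure_sigma_additive.

Let cons_measure_sigma_finite : sigma_finite setT cons_measure.
Proof.
have /sigma_finiteP[F [TF ndF Foo]] := sigma_finiteT mu.
have /sigma_finiteP[G [TG ndG Goo]] := sigma_finiteT nu.
exists (fun k => [set t | F k (thead t)] `&` [set t | G k (tail t)]).
  apply/esym; rewrite -subTset => t _.
  have [i _ Fi] : (\bigcup_k F k) (thead t) by rewrite -TF.
  have [j _ Gj] : (\bigcup_k G k) (tail t) by rewrite -TG.
  exists (maxn i j) => //; split => /=.
  - by move: Fi; exact/subsetPset/ndF/leq_maxl.
  - by move: Gj; exact/subsetPset/ndG/leq_maxr.
move=> k; have [mF Fk] := Foo k; have [mG Gk] := Goo k; split.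
  apply: measurableI; rewrite -[X in measurable X]setTI.
  - exact: (measurable_tnth (T := T) (@ord0 n)).
  - exact: (measurable_behead (T := T) (n := n)).
set A := _ `&` _.
have -> : cons_measure A = (mu \x nu)%E (F k `*` G k).
  rewrite /cons_measure /pushforward; congr product_measure1.
  by apply/seteqP; split => -[x t] [] /=; rewrite /A /= consK.
rewrite product_measure1E//.
by rewrite lte_mul_pinfty// ge0_fin_numE.
Qed.

HB.instance Definition _ := Measure_isSigmaFinite.Build _ _ _ cons_measure
  cons_measure_sigma_finite.

End step.

Definition nil_measure : set (0.-tuple T) -> \bar R := @dirac _ _ [tuple] R.
HB.instance Definition _ := Measure.on nil_measure.
Let nil_measure_sigma_finite : sigma_finite setT nil_measure.
Proof.
exists (fun=> setT); first by rewrite bigcup_const//; exists 0%N.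
by move=> k; split => //; rewrite /nil_measure diracT ltry.
Qed.
HB.instance Definition _ := Measure_isSigmaFinite.Build _ _ _ nil_measure
  nil_measure_sigma_finite.

Fixpoint power_measure (mu : {sigma_finite_measure set T -> \bar R}) n :
    {sigma_finite_measure set (n.-tuple T) -> \bar R} :=
  if n is m.+1 then cons_measure mu (power_measure mu m) else nil_measure.

End power_measure.

Section complex_space.
Context {R : realType}.

(* R^2n -> C^n, (u, v) |-> u + i v. *)
Definition Cn_point n (t : (n + n).-tuple R) : 'rV[R[i]]_n :=
  \row_j (tnth t (lshift n j) +i* tnth t (rshift n j))%C.

(* Lebesgue measure on C^n, carried by the real coordinates. *)
Definition lebesgueC n := power_measure (@lebesgue_measure R) (n + n).

Definition integralC n (A : set 'rV[R[i]]_n) (f : 'rV[R[i]]_n -> \bar R) :=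
  (\int[lebesgueC n]_(t in @Cn_point n @^-1` A) f (Cn_point t))%E.

Definition integrableC n (A : set 'rV[R[i]]_n) (f : 'rV[R[i]]_n -> \bar R) :=
  (lebesgueC n).-integrable (@Cn_point n @^-1` A) (f \o @Cn_point n).

Definition cabs (z : R[i]) : R := complex.Re `|z|.

Definition polydisc n : set 'rV[R[i]]_n := [set z | forall j, cabs (z 0 j) < 1].

Definition usc_on n (D : set 'rV[R[i]]_n) (f : 'rV[R[i]]_n -> \bar R) :=
  forall z (a : R), D z -> (f z < a%:E)%E ->
    \forall w \near z, D w -> (f w < a%:E)%E.

(* Upper semicontinuous [-oo, +oo[-valued functions satisfying the sub-mean
   value inequality on every closed disc of a complex line contained in D;
   the values of f outside D are irrelevant. *)
Definition psh_on n (D : set 'rV[R[i]]_n) (f : 'rV[R[i]]_n -> \bar R) :=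
  [/\ forall z, D z -> (f z < +oo)%E,
      usc_on D f &
      forall a b, (forall w : R[i], cabs w <= 1 -> D (a + w *: b)) ->
        (f a <= ((2 * pi)^-1)%:E *
          \int[lebesgue_measure]_(theta in `[0%R, (2 * pi)%R])
            f (a + (cos theta +i* sin theta)%C *: b)%R)%E].

Definition toric n (Psi : 'rV[R[i]]_n -> \bar R) :=
  forall z, polydisc z -> Psi z = Psi (\row_j `|z 0 j|).

Definition isolated_singularity0 n (Psi : 'rV[R[i]]_n -> \bar R) :=
  forall p, polydisc p -> p != 0 ->
    exists M : R, \forall z \near p, polydisc z -> (`|Psi z| <= M%:E)%E.

Definition lct0 n (Psi : 'rV[R[i]]_n -> \bar R) : \bar R :=
  ereal_sup [set c%:E | c in [set c : R | 0 <= c /\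
    exists U : set 'rV[R[i]]_n, [/\ open_nbhs (0 : 'rV[R[i]]_n) U, U `<=` @polydisc n &
      integrableC U (fun z => expeR (- (c%:E * Psi z))%E)]]].

Definition nonneg_orthant n : set 'rV[R]_n := [set x | forall j, 0 <= x 0 j].
Definition neg_orthant n : set 'rV[R]_n := [set x | forall j, x 0 j < 0].

Definition newton_convex n (P : set 'rV[R]_n) :=
  [/\ closed P, convex_set (P : set (convex_lmodType 'rV[R]_n)),
      P `<=` @nonneg_orthant n &
      [set x + y | x in P & y in @nonneg_orthant n] = P].

Definition support_fun n (P : set 'rV[R]_n) (x : 'rV[R]_n) : \bar R :=
  ereal_sup [set (\sum_j alpha 0 j * x 0 j)%:E | alpha in P].

(* Psi determines g on neg_orthant; convexity and monotonicity of g there are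
   consequences for toric psh Psi, not assumptions. *)
Definition toric_profile n (Psi : 'rV[R[i]]_n -> \bar R) (g : 'rV[R]_n -> R) :=
  forall z, polydisc z -> (forall j, z 0 j != 0) ->
    Psi z = (g (\row_j ln (cabs (z 0 j) ^+ 2)))%:E.

(* The empty P is excluded, since its support function is -oo. *)
Definition newton_body_of n (Psi : 'rV[R[i]]_n -> \bar R) (P : set 'rV[R]_n) :=
  newton_convex P /\
  exists g, toric_profile Psi g /\
    (ereal_sup [set `|(g x)%:E - support_fun P x| | x in @neg_orthant n]
      < +oo)%E.

Definition boundary n (P : set 'rV[R]_n) := closure P `\` interior P.

Definition locally_hyperplane1 n (P : set 'rV[R]_n) :=
  exists r : R, 0 < r /\ exists alpha : 'rV[R]_n,
    let B := [set x : 'rV[R]_n | \sum_j (x 0 j - 1) ^+ 2 < r ^+ 2] in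
    [/\ forall j, 0 <= alpha 0 j, \sum_j alpha 0 j = 1 &
        [set x | B x /\ 0 <= \sum_j alpha 0 j * (x 0 j - 1)] = P `&` B].

(* An (n, n)-form is given by its coefficient g with respect to the Lebesgue
   volume form. *)
Definition ohsawa_norm n (Psi : 'rV[R[i]]_n -> \bar R) (U : set 'rV[R[i]]_n)
    (g : 'rV[R[i]]_n -> R) : \bar R :=
  ereal_sup [set limf_esup (fun t : R =>
      integralC ([set z | (t%:E < Psi z < (t + 1)%:E)%E] `&` K)
        (fun z => (g z)%:E * expeR (- Psi z))%E) (ninfty_nbhs R)
    | K in [set K | compact K /\ K `<=` U]].

Definition ohsawa_singular n (Psi : 'rV[R[i]]_n -> \bar R) (p : 'rV[R[i]]_n) :=
  forall (U : set 'rV[R[i]]_n) (g : 'rV[R[i]]_n -> R),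
    open_nbhs p U -> U `<=` @polydisc n ->
    {within U, continuous g} -> (forall z, U z -> 0 <= g z) -> g p != 0 ->
    ohsawa_norm Psi U g = +oo%E.

End complex_space.

(* Main.v *)
Require Import Defs.
From mathcomp Require Import all_boot all_order all_algebra.
From mathcomp Require Import complex.
From mathcomp Require Import all_classical all_reals all_analysis.
From mathcomp Require Import measurable_realfun.
From mathcomp Require Import ring lra.

Import Order.TTheory GRing.Theory Num.Theory.
Import numFieldTopology.Exports numFieldNormedType.Exports.

Local Open Scope classical_set_scope.
Local Open Scope ring_scope.

Set Implicit Arguments.
Unset Strict Implicit.
Unset Printing Implicit Defensive.

(** In the coordinates x_j = ln |z_j|^2 the Lebesgue measure of C^n is, up to a
    constant, e^{x_1 + .. + x_n} dx, and Psi differs from h_P(x) by a bounded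
    amount. Hence the Ohsawa norm is not singular iff the regions
    {t < h_P(x) < t + 1, h_P(x) - sum x = O(1)}, exponentially weighted, have
    bounded volume as t -> -oo; c_0(Psi) = 1 says that (1, .., 1) is a boundary
    point of P, so h_P(x) >= sum x with equality on a ray -s alpha.

    If P is locally the half-space orthogonal to alpha, then h_P(x) - sum x
    dominates the distance from x to that ray, and the integrand is bounded by
    a product of one-variable functions of integral independent of t.

    Conversely, let e satisfy h_P(e) <= sum e + 1. By convexity the strip
    spanned by the ray and e has bounded h_P(x) - sum x, and a far section of it
    has length at least the distance from e to the ray; so this distance is
    bounded when the norm is finite, and then by polarity P contains a
    neighbourhood of (1, .., 1) in the half-space. *)

(** * Integrals over power measures *)

Section product_integrals.
Context {R : realType}.

(* Unlike ge0_le_integral, it applies to nonmeasurable data: the integral is a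
   supremum over the simple functions below f. *)
Lemma le_ge0_integral d (T : measurableType d)
    (mu : {measure set T -> \bar R}) (D1 D2 : set T) (f1 f2 : T -> \bar R) :
  (forall x, D1 x -> 0 <= f1 x)%E -> (forall x, D2 x -> 0 <= f2 x)%E ->
  (forall x, D1 x -> D2 x /\ (f1 x <= f2 x)%E) ->
  (\int[mu]_(x in D1) f1 x <= \int[mu]_(x in D2) f2 x)%E.
Proof.
move=> f10 f20 f12; rewrite !ge0_integralE//.
apply: le_ereal_sup => _ [h /= hf <-]; exists h => //= x.
apply: (le_trans (hf x)); rewrite !patchE.
case: ifPn => [/[!inE] xD1|_].
  by have [xD2 ?] := f12 _ xD1; rewrite ifT// inE.
by case: ifPn => // /[!inE]; exact: f20.
Qed.

Lemma ge0_integral_ge_cst d (T : measurableType d)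
    (mu : {measure set T -> \bar R}) (D A : set T) (f : T -> \bar R) (c : R) :
  measurable A -> 0 <= c -> (forall x, D x -> 0 <= f x)%E ->
  (forall x, A x -> D x /\ (c%:E <= f x)%E) ->
  (c%:E * mu A <= \int[mu]_(x in D) f x)%E.
Proof.
move=> mA c0 f0 cf; rewrite -integral_cst//.
by apply: le_ge0_integral => // x _; rewrite lee_fin.
Qed.

Section power.
Context d (T : measurableType d) (mu : {sigma_finite_measure set T -> \bar R}).

Lemma measurable_fun_prode d' (X : measurableType d')
    (I : Type) (s : seq I)
    (f : I -> X -> \bar R) : (forall i, measurable_fun [set: X] (f i)) ->
  measurable_fun [set: X] (fun x => \prod_(i <- s) f i x)%E.
Proof.
move=> mf; elim: s => [|i s ih].
  by under eq_fun do rewrite big_nil; exact: measurable_cst.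
by under eq_fun do rewrite big_cons; exact: emeasurable_funM.
Qed.

Lemma measurable_prod_tnth m (f : 'I_m -> T -> \bar R) :
  (forall i, measurable_fun [set: T] (f i)) ->
  measurable_fun [set: m.-tuple T] (fun t => \prod_(i < m) f i (tnth t i))%E.
Proof.
move=> mf; apply: (@measurable_fun_prode _ (m.-tuple T) _ _
  (fun i t => f i (tnth t i))) => i.
apply: (measurableT_comp (mf i)); exact: measurable_tnth.
Qed.

(** Tonelli, by induction on the number of factors: the head coordinate is split off through the
    pushforward that defines the power measure. *)
Lemma integral_power_measure_prod m (f : 'I_m -> T -> \bar R) :
  (forall i, measurable_fun [set: T] (f i)) -> (forall i x, 0 <= f i x)%E ->
  (\int[power_measure mu m]_t \prod_(i < m) f i (tnth t i) =
   \prod_(i < m) \int[mu]_x f i x)%E.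
Proof.
elim: m f => [|m ih] f mf f0.
  rewrite big_ord0; under eq_integral do rewrite big_ord0.
  by rewrite /= integral_cst//= /nil_measure diracT mule1.
rewrite big_ord_recl/= /cons_measure.
rewrite (@ge0_integral_pushforward _ _ _ _ R _ (@measurable_tuple_cons _ T m)
  (mu \x power_measure mu m)%E)//; last 2 first.
  exact: measurable_prod_tnth.
  by move=> t _; apply: prode_ge0.
rewrite preimage_setT.
transitivity (\int[mu \x power_measure mu m]_z
   (f ord0 z.1 * \prod_(i < m) f (lift ord0 i) (tnth z.2 i)))%E.
  apply: eq_integral => -[x t] _ /=; rewrite big_ord_recl/=.
  congr (_ * _)%E; apply: eq_bigr => i _; congr f.
  by rewrite tnthS.
have mP := @measurable_prod_tnth m (fun i => f (lift ord0 i))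
    (fun i => mf (lift ord0 i)).
have mF : measurable_fun [set: T * m.-tuple T] (fun z =>
   (f ord0 z.1 * \prod_(i < m) f (lift ord0 i) (tnth z.2 i))%E).
  apply: emeasurable_funM; first exact: measurableT_comp.
  exact: (measurableT_comp mP measurable_snd).
rewrite fubini_tonelli1//; last by move=> z; rewrite mule_ge0// prode_ge0.
rewrite /fubini_F/=.
under eq_integral => x _.
  rewrite ge0_integralZl//; last by move=> t _; exact: prode_ge0.
  rewrite (ih (fun i => f (lift ord0 i)))//.
  over.
rewrite ge0_integralZr// prode_ge0// => i _; exact: integral_ge0.
Qed.

Definition tuple_box m (A : 'I_m -> set T) : set (m.-tuple T) :=
  [set t | forall i, A i (tnth t i)].

Lemma indic_tuple_box m (A : 'I_m -> set T) (t : m.-tuple T) :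
  (\1_(tuple_box A) t)%:E = (\prod_(i < m) (\1_(A i) (tnth t i))%:E)%E :> \bar R.
Proof.
rewrite prodEFin; congr EFin; rewrite indicE.
have [At|At] := pselect (tuple_box A t).
  by rewrite mem_set// big1// => i _; rewrite indicE mem_set.
have /existsNP[i Ati] : ~ forall i, A i (tnth t i) := At.
by rewrite memNset// (bigD1 i)//= indicE memNset// mul0r.
Qed.

Lemma measurable_tuple_box m (A : 'I_m -> set T) :
  (forall i, measurable (A i)) -> measurable (tuple_box A).
Proof.
move=> mA; have -> : tuple_box A =
    \bigcap_i ((fun t : m.-tuple T => tnth t i) @^-1` A i).
  by apply/seteqP; split=> t At i; [move=> _|]; exact: At.
apply: fin_bigcap_measurable => //= i _; rewrite -[X in measurable X]setTI.
exact: (measurable_tnth (T := T) i).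
Qed.

Lemma power_measure_box m (A : 'I_m -> set T) :
  (forall i, measurable (A i)) ->
  power_measure mu m (tuple_box A) = (\prod_(i < m) mu (A i))%E.
Proof.
move=> mA; rewrite -(setIT (tuple_box A)) -integral_indic//; last first.
  exact: measurable_tuple_box.
under eq_integral do rewrite indic_tuple_box.
rewrite (integral_power_measure_prod (f := fun i x => (\1_(A i) x)%:E))//.
  by apply: eq_bigr => i _; rewrite integral_indic// setIT.
by move=> i; apply/measurable_EFinP; exact: measurable_indic.
Qed.

End power.
End product_integrals.

(** * Topology of C^n in real coordinates *)

Section complex_topology.
Context {R : realType}.

Lemma cabsE (z : R[i]) : cabs z = Num.sqrt (complex.Re z ^+ 2 + complex.Im z ^+ 2).
Proof. by case: z. Qed.

Lemma normC_cabs (z : R[i]) : `|z| = (cabs z)%:C%C.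
Proof. by case: z. Qed.

Lemma ltC_real (a : R) (e : R[i]) :
  (a%:C%C < e) = (complex.Im e == 0) && (a < complex.Re e).
Proof. by case: e => x y; rewrite ltcE/=. Qed.

(** The norm of [R[i]] takes values in [R[i]], so balls have complex radii; positivity forces such a
    radius to be real, which gives back the usual neighbourhoods. *)
Lemma nbhsC_cabs n (z : 'rV[R[i]]_n) (A : set 'rV[R[i]]_n) : nbhs z A <->
  exists2 r : R, 0 < r &
    forall w : 'rV[R[i]]_n, (forall j, cabs (z 0 j - w 0 j) < r) -> A w.
Proof.
split=> [/nbhs_ballP[e /= e0 eA]|[r r0 rA]].
  have := e0; rewrite -[0]/(0%:C%C) ltC_real => /andP[ime ree].
  exists (complex.Re e) => // w zw; apply: eA.
  split=> // i j; rewrite ord1; change (`|z 0 j - w 0 j| < e).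
  by rewrite normC_cabs ltC_real ime zw.
apply/nbhs_ballP; exists (r%:C%C).
  by rewrite /= -[0]/(0%:C%C) ltC_real/= eqxx.
move=> w [_ zw]; apply: rA => j; have : `|z 0 j - w 0 j| < r%:C%C := zw 0 j.
by rewrite normC_cabs ltC_real/= eqxx.
Qed.

Lemma cabs_le_Re_Im (z : R[i]) : cabs z <= `|complex.Re z| + `|complex.Im z|.
Proof.
rewrite cabsE -[leRHS]ger0_norm ?addr_ge0// -sqrtr_sqr ler_wsqrtr//.
rewrite sqrrD !real_normK ?num_real// -addrA [_ *+ 2 + _]addrC addrA lerDl.
by rewrite mulrn_wge0// mulr_ge0.
Qed.

Lemma cabsD (z w : R[i]) : cabs (z + w) <= cabs z + cabs w.
Proof.
by rewrite -lecR rmorphD/= -!normC_cabs ler_normD.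
Qed.

Lemma cabs_distC (z w : R[i]) : cabs (z - w) = cabs (w - z).
Proof. by rewrite /cabs distrC. Qed.

Lemma cabs0 : cabs (0 : R[i]) = 0.
Proof. by rewrite /cabs normr0. Qed.

Lemma open_polydisc n : open (@polydisc R n).
Proof.
rewrite openE => z Dz; apply/nbhsC_cabs.
exists (\big[Order.min/1]_j (1 - cabs (z 0 j))).
  elim/big_ind : _ => // [x y x0 y0|j _]; first by rewrite lt_min x0.
  by rewrite subr_gt0.
move=> w zw j; rewrite -(subrK (z 0 j) (w 0 j)).
apply: (le_lt_trans (cabsD _ _)); rewrite -ltrBrDr cabs_distC.
by apply: (lt_le_trans (zw j)); exact: bigmin_le_cond.
Qed.

Lemma Re_Cn_point n (t : (n + n).-tuple R) j :
  complex.Re (Cn_point t 0 j) = tnth t (lshift n j).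
Proof. by rewrite mxE. Qed.

Lemma Im_Cn_point n (t : (n + n).-tuple R) j :
  complex.Im (Cn_point t 0 j) = tnth t (rshift n j).
Proof. by rewrite mxE. Qed.

Lemma cabs_Cn_point_lt n (s t : (n + n).-tuple R) (r : R) :
  (forall i, `|tnth s i - tnth t i| < r / 2) ->
  forall j, cabs (Cn_point s 0 j - Cn_point t 0 j) < r.
Proof.
move=> st j; apply: (le_lt_trans (cabs_le_Re_Im _)); rewrite !mxE/=.
by rewrite [r]splitr ltrD.
Qed.

(** The sigma-algebra on tuples is the product one, so an open set is written as a countable union
    of cubes with rational centres and radii 1/(k + 1). *)
Lemma measurable_Cn_point_open n (O : set 'rV[R[i]]_n) :
  open O -> measurable (@Cn_point R n @^-1` O).
Proof.
move=> oO.
pose box (u : (n + n).-tuple rat * nat) : set ((n + n).-tuple R) :=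
  tuple_box (fun i => [set x : R | `|ratr (tnth u.1 i) - x| < u.2.+1%:R^-1] : set R).
pose good u := box u `<=` @Cn_point R n @^-1` O.
have -> : @Cn_point R n @^-1` O =
    \bigcup_(u in [set: (n + n).-tuple rat * nat]) (if `[< good u >] then box u else set0).
  apply/seteqP; split=> [t Ot|t [u _]]; last by case: asboolP => // gu /gu.
  have /nbhsC_cabs[r r0 rO] : nbhs (Cn_point t) O by exact: open_nbhs_nbhs.
  (* In each real coordinate the given point and any point of the cube are within r/4 of the centre,
     hence within r/2 of each other. *)
  have [k kr] : exists k, k.+1%:R^-1 < r / 4.
    have r4 : 0 < r / 4 by rewrite divr_gt0.
    by have [k] := ltr_add_invr r4; rewrite add0r; exists k.
  have rat_ex i : exists q : rat, `|ratr q - tnth t i| < k.+1%:R^-1.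
    have [q] : exists q, ratr q \in
        `](tnth t i - k.+1%:R^-1), (tnth t i + k.+1%:R^-1)[.
      by apply: rat_in_itvoo; rewrite ltrBlDr -addrA ltrDl addr_gt0 ?invr_gt0.
    by rewrite in_itv/= -ltr_distl; exists q.
  exists ([tuple sval (cid (rat_ex i)) | i < n + n], k) => //.
  case: asboolP => [_|]; first by move=> i /=; rewrite tnth_mktuple; case: cid.
  case=> s sb; apply: rO; apply: cabs_Cn_point_lt => i.
  have := sb i; rewrite /= tnth_mktuple; case: cid => q /= qt qs.
  rewrite -(subrK (ratr q) (tnth t i)) -addrA.
  apply: (le_lt_trans (ler_normD _ _)); rewrite distrC.
  rewrite (_ : r / 2 = r / 4 + r / 4); last by field.
  by rewrite ltrD// (lt_trans _ kr).
apply: countable_bigcupT_measurable; first exact: countableP.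
move=> u; case: asboolP => // _; apply: measurable_tuple_box => i.
rewrite (_ : [set x | _] = `](ratr (tnth u.1 i) - u.2.+1%:R^-1), (ratr (tnth u.1 i) + u.2.+1%:R^-1)[%classic)//.
by apply/seteqP; split=> x /=; rewrite in_itv/= distrC ltr_distl.
Qed.

(** These sets are the test compacts for the Ohsawa norm; each factor is the image of a real square
    under (u, v) |-> u + i v. *)
Lemma compact_Re_Im n (r : R) :
  compact [set z : 'rV[R[i]]_n | forall j,
    `|complex.Re (z 0 j)| <= r /\ `|complex.Im (z 0 j)| <= r].
Proof.
apply: (@rV_compact R[i] n
  (fun=> [set w : R[i] | `|complex.Re w| <= r /\ `|complex.Im w| <= r])) => _.
pose f (x : R * R) : R[i] := (x.1 +i* x.2)%C.
have -> : [set w : R[i] | `|complex.Re w| <= r /\ `|complex.Im w| <= r] =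
    f @` (`[- r, r]%classic `*` `[- r, r]%classic).
  apply/seteqP; split => [[u v] /= [ur vr]|_ [[u v] /= [ur vr] <-]].
    by exists (u, v) => //=; rewrite !in_itv/= -!ler_norml.
  by move: ur vr; rewrite !in_itv/= -!ler_norml.
apply: continuous_compact; last by apply: compact_setX; exact: segment_compact.
apply: continuous_subspaceT => -[u v]; apply/cvg_ballP => e /= e0.
have := e0; rewrite -[0]/(0%:C%C) ltC_real => /andP[ime ree].
exists (ball u (complex.Re e / 2), ball v (complex.Re e / 2)).
  by split; apply: nbhsx_ballx; rewrite divr_gt0.
move=> [x y] /= [ux vy]; change (`|f (u, v) - f (x, y)| < e).
rewrite normC_cabs ltC_real ime/=.
apply: (le_lt_trans (cabs_le_Re_Im _)); rewrite /=.
by rewrite [ltRHS]splitr ltrD.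
Qed.

Lemma measurable_fun_usc n (D : set 'rV[R[i]]_n) (f : 'rV[R[i]]_n -> \bar R) :
  open D -> usc_on D f ->
  measurable_fun (@Cn_point R n @^-1` D) (f \o @Cn_point R n).
Proof.
move=> oD uf; apply: (measurability _ (ErealGenInftyO.measurableE R)).
move=> _ [_ [a ->] <-].
rewrite [X in measurable X](_ : _ =
    @Cn_point R n @^-1` (D `&` [set z | (f z < a%:E)%E])); last first.
  by apply/seteqP; split=> t /=; rewrite in_itv/=.
apply: measurable_Cn_point_open; rewrite openE => z [Dz fz].
have := uf z a Dz fz; have : \forall w \near z, D w by exact: open_nbhs_nbhs.
by apply: filterS2 => w Dw fw; split => //; exact: fw.
Qed.

Lemma Re_le_cabs (z : R[i]) : `|complex.Re z| <= cabs z.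
Proof. by rewrite cabsE -sqrtr_sqr ler_wsqrtr// lerDl sqr_ge0. Qed.

Lemma Im_le_cabs (z : R[i]) : `|complex.Im z| <= cabs z.
Proof. by rewrite cabsE -sqrtr_sqr ler_wsqrtr// lerDr sqr_ge0. Qed.

End complex_topology.

(** * An integrable majorant in one real variable *)

Section log_kernel.
Context {R : realType}.
Implicit Types (e b u : R).

(* +oo at 0 keeps the kernel a majorant there, where ln 0 = 0 is a junk value. *)
Definition log_kernel e b u : \bar R :=
  if u == 0 then +oo%E else (expR (- ln `|u| - e * `|ln `|u| - b|))%:E.

Lemma log_kernel_ge0 e b u : (0 <= log_kernel e b u)%E.
Proof. by rewrite /log_kernel; case: ifP => // _; rewrite lee_fin expR_ge0. Qed.

Lemma measurable_log_kernel e b : measurable_fun [set: R] (log_kernel e b).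
Proof.
apply: measurable_fun_ifT => //=.
  apply: (measurable_fun_bool true); rewrite setTI.
  rewrite (_ : _ @^-1` _ = [set 0])//.
  apply/seteqP; split=> u /=; first by move/eqP.
  by move=> ->; rewrite eqxx.
have mln : measurable_fun [set: R] (fun u => ln `|u|).
  exact: (measurableT_comp (@measurable_ln R) (@normr_measurable R setT)).
apply/measurable_EFinP; apply: measurableT_comp => //.
apply: measurable_funB; first exact: measurableT_comp.
apply: measurable_funM => //; apply: measurableT_comp => //.
exact: measurable_funB.
Qed.

Let w e b u := expR (e * (ln u - b)).
Let k e b u := 2 * w e b u / (u * (1 + w e b u ^+ 2)).
Let F e b u := 2 / e * atan (w e b u).

Let den_gt0 e b u : 0 < u -> 0 < u * (1 + w e b u ^+ 2).
Proof. by move=> u0; rewrite mulr_gt0// ltr_pwDl// sqr_ge0. Qed.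

Let k_ge0 e b u : 0 < u -> 0 <= k e b u.
Proof.
move=> u0; apply: divr_ge0; last exact/ltW/den_gt0.
by rewrite mulr_ge0// expR_ge0.
Qed.

Let derive_F e b u : 0 < e -> 0 < u -> is_derive u 1 (F e b) (k e b u).
Proof.
move=> e0 u0.
have dln := is_derive1_ln u0.
have dl : is_derive u 1 (fun u => ln u - b) (u^-1 - 0).
  exact: (is_deriveB dln (is_derive_cst b u 1)).
have dm : is_derive u 1 (fun u => e * (ln u - b)) (e *: (u^-1 - 0)).
  by have := is_deriveZ e dl.
have dw : is_derive u 1 (w e b) (expR (e * (ln u - b)) * (e *: (u^-1 - 0))).
  exact: (is_derive1_comp (is_derive_expR _) dm).
have da : is_derive u 1 (atan \o w e b)
   ((1 + w e b u ^+ 2)^-1 * (expR (e * (ln u - b)) * (e *: (u^-1 - 0)))).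
  exact: (is_derive1_comp (is_derive1_atan _) dw).
have := @is_deriveZ _ _ _ _ (2 / e) _ _ _ da; rewrite /F /k.
move/is_derive_eq; apply.
have := den_gt0 e b u0; rewrite /GRing.scale/= subr0 -/(w e b u) => d0.
have w2 : 1 + w e b u ^+ 2 != 0 by rewrite gt_eqF// ltr_pwDl// sqr_ge0.
by field; rewrite w2 !gt_eqF.
Qed.

Let continuous_k e b u : 0 < u -> {for u, continuous (k e b)}.
Proof.
move=> u0.
have cw : {for u, continuous (w e b)}.
  apply: continuous_comp; last exact: continuous_expR.
  apply: cvgM; first exact: cvg_cst.
  by apply: cvgB; [exact: continuous_ln|exact: cvg_cst].
apply: cvgM; first by apply: cvgM => //; exact: cvg_cst.
apply: cvgV; first by rewrite gt_eqF// den_gt0.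
apply: cvgM; first exact: cvg_id.
apply: cvgD; first exact: cvg_cst.
by rewrite /GRing.exp/=; exact: cvgM.
Qed.

(** The values of atan w lie between 0 and pi/2, so [F] grows by at most (2/e)(pi/2), whatever b, c
    and d. *)
Let integral_k e b c d : 0 < e -> 0 < c -> c < d ->
  (\int[lebesgue_measure]_(u in `[c, d]) (k e b u)%:E <= (pi / e)%:E)%E.
Proof.
move=> e0 c0 cd.
have pos u : u \in `]c, d[ -> 0 < u.
  by rewrite in_itv/= => /andP[cu _]; exact: lt_trans cu.
have ck u : 0 < u -> k e b u @[u --> u] --> k e b u by exact: continuous_k.
have cF u : 0 < u -> {for u, continuous (F e b)}.
  move=> u0; apply: differentiable_continuous.
  by apply/derivable1_diffP; have [] := derive_F b e0 u0.
rewrite (@continuous_FTC2 _ (k e b) (F e b))//.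
- rewrite -EFinB lee_fin /F -mulrBr.
  have /andP[a1 a2] : - (pi / 2) < atan (w e b d) < pi / 2.
    by rewrite atan_gtNpi2 atan_ltpi2.
  have a3 : 0 <= atan (w e b c).
    by rewrite -atan0 ltW// lt_atan// expR_gt0.
  rewrite (_ : pi / e = 2 / e * (pi / 2)); last by field; rewrite gt_eqF.
  rewrite ler_wpM2l ?divr_ge0 ?ltW//; lra.
- apply/continuous_within_itvP => //; split.
  + by move=> u /pos; exact: continuous_k.
  + by apply: cvg_at_right_filter; exact: continuous_k.
  + by apply: cvg_at_left_filter; apply: continuous_k; exact: lt_trans cd.
- split.
  + by move=> u /pos u0; have [] := derive_F b e0 u0.
  + by apply: cvg_at_right_filter; exact: cF.
  + by apply: cvg_at_left_filter; apply: cF; exact: lt_trans cd.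
- by move=> u /pos u0; rewrite derive1E; have [_] := derive_F b e0 u0.
Qed.

(* k = 2 / (u (w + 1/w)) with w = exp(e (ln u - b)), and 1 / max(w, 1/w) is at
   most 2 / (w + 1/w); unlike the absolute value, k has the explicit
   primitive F. *)
Let log_kernel_le_k e b u : 0 < e -> 0 < u -> (log_kernel e b u <= (k e b u)%:E)%E.
Proof.
move=> e0 u0; rewrite /log_kernel gt_eqF// lee_fin gtr0_norm//.
rewrite expRD expRN lnK ?posrE// /k.
have -> : 2 * w e b u / (u * (1 + w e b u ^+ 2)) =
    u^-1 * (2 * w e b u / (1 + w e b u ^+ 2)).
  by field; rewrite !gt_eqF// ltr_pwDl// sqr_ge0.
rewrite ler_wpM2l ?invr_ge0 ?(ltW u0)//.
rewrite ler_pdivlMr ?ltr_pwDl ?sqr_ge0//.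
have [h|h] := leP b (ln u).
  have -> : expR (- (e * `|ln u - b|)) = (w e b u)^-1.
    by rewrite ger0_norm ?subr_ge0// expRN.
  have w1 : 1 <= w e b u by rewrite -expR0 ler_expR mulr_ge0 ?subr_ge0// ltW.
  have w0 : 0 < w e b u by rewrite expR_gt0.
  rewrite mulrC ler_pdivrMr//; nra.
have -> : expR (- (e * `|ln u - b|)) = w e b u.
  by rewrite ltr0_norm ?subr_lt0// mulrN opprK.
have w1 : w e b u <= 1 by rewrite -expR0 ler_expR pmulr_rle0// subr_le0 ltW.
have w0 : 0 < w e b u by rewrite expR_gt0.
nra.
Qed.

(** In the variable y = ln |u| each half-line contributes the integral of exp(-e |y - b|) dy, which
    does not depend on b; the majorant [k] replaces its value 2/e by pi/e. *)
Lemma integral_log_kernel e b : 0 < e ->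
  (\int[lebesgue_measure]_u log_kernel e b u <= (2 * pi / e)%:E)%E.
Proof.
move=> e0; have mk : measurable_fun [set: measurableTypeR R] (log_kernel e b).
  exact: measurable_log_kernel.
rewrite (@ge0_negligible_integral _ _ R lebesgue_measure setT [set 0])//; last 2 first.
  by move=> u _; exact: log_kernel_ge0.
  exact: lebesgue_measure_set1.
pose c n : R := n.+2%:R^-1.
have c0 n : 0 < c n by rewrite invr_gt0.
have cd n : c n < n.+2%:R.
  by rewrite (@lt_trans _ _ 1)// ?invf_lt1// ltr1n.
(* The complement of 0 is exhausted by pairs of compact intervals, on which the bound for [k]
   applies; monotone convergence concludes. *)
pose A n : set (measurableTypeR R) := `[- n.+2%:R, - c n]%classic `|` `[c n, n.+2%:R]%classic.
have -> : [set: R] `\` [set 0] = \bigcup_n A n.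
  apply/seteqP; split => [u [_ /eqP u0]|u [n _] Anu]; last first.
    split=> //= u0; have := c0 n.
    by case: Anu; rewrite u0 /= in_itv/= => /andP[]; lra.
  have [n1 hn1] : exists n, c n < `|u|.
    have u1 : 0 < `|u| by rewrite normr_gt0.
    have [n] := ltr_add_invr u1; rewrite add0r => h; exists n.
    by apply: lt_trans h; rewrite ltf_pV2 ?posrE// ltr_nat.
  have [n2 hn2] : exists n, `|u| < n.+2%:R.
    exists (Num.truncn `|u|); apply: (lt_trans (truncnS_gt _)).
    by rewrite ltr_nat.
  exists (maxn n1 n2) => //.
  have h1 : c (maxn n1 n2) <= `|u|.
    apply/ltW/(le_lt_trans _ hn1).
    by rewrite lef_pV2 ?posrE// ler_nat !ltnS leq_maxl.
  have h2 : `|u| <= (maxn n1 n2).+2%:R.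
    apply/ltW/(lt_le_trans hn2).
    by rewrite ler_nat !ltnS leq_maxr.
  have [u0'|u0'] := leP 0 u.
    by right; rewrite /= in_itv/= -{1 2}(ger0_norm u0') h1.
  by left; rewrite /= in_itv/= lerNl lerNr -(ltr0_norm u0') h1 h2.
have mA n : measurable (A n) by apply: measurableU; exact: measurable_itv.
have ndA : {homo A : n m / (n <= m)%N >-> (n <= m)%O}.
  move=> n m nm; apply/subsetPset => u.
  have h1 : c m <= c n by rewrite lef_pV2 ?posrE// ler_nat !ltnS.
  have h2 : n.+2%:R <= m.+2%:R :> R by rewrite ler_nat !ltnS.
  by rewrite /A /= !in_itv/=; case=> /andP[? ?]; [left|right]; apply/andP; split; lra.
have := @ge0_nondecreasing_set_cvg_integral _ (measurableTypeR R) R A (log_kernel e b)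
  lebesgue_measure ndA mA (fun n => measurable_funS measurableT (@subsetT _ _) mk)
  (fun n u _ => log_kernel_ge0 e b u).
move=> cvgA; rewrite -(cvg_lim _ cvgA)//.
apply: lime_le; first by apply/cvg_ex; eexists; exact: cvgA.
near=> n.
rewrite ge0_integral_setU//; last 3 first.
- exact: measurable_funS mk.
- by move=> u _; exact: log_kernel_ge0.
- apply/disj_setPS => u /= []; rewrite !in_itv/= => /andP[_ u1] /andP[u2 _].
  by have := c0 n; lra.
rewrite (_ : 2 * pi / e = pi / e + pi / e); last by field; rewrite gt_eqF.
rewrite EFinD leeD//.
  apply: (@le_trans _ _ (\int[lebesgue_measure]_(u in `[(- n.+2%:R)%R, (- c n)%R])
     ((k e b \o -%R) u)%:E)%E).
    apply: le_ge0_integral => u; rewrite /= in_itv/= => /andP[u1 u2].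
    - exact: log_kernel_ge0.
    - by rewrite lee_fin k_ge0// oppr_gt0 (le_lt_trans u2)// oppr_lt0.
    - have u0 : 0 < - u by rewrite oppr_gt0 (le_lt_trans u2)// oppr_lt0.
      split; first exact/andP.
      rewrite (_ : log_kernel e b u = log_kernel e b (- u)).
        exact: log_kernel_le_k.
      by rewrite /log_kernel oppr_eq0 normrN.
  rewrite integration_by_substitution_oppr//; first last.
  - apply/continuous_within_itvP; first by rewrite ltrN2.
    have ck u : u <= - c n -> {for u, continuous (k e b \o -%R)}.
      move=> u2; apply: continuous_comp; first exact: continuousN.
      by apply: continuous_k; rewrite oppr_gt0 (le_lt_trans u2)// oppr_lt0.
    split.
    + by move=> u; rewrite in_itv/= => /andP[_ u2]; apply: ck; exact: ltW.
    + by apply: cvg_at_right_filter; apply: ck; rewrite lerN2 ltW.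
    + by apply: cvg_at_left_filter; apply: ck.
  - exact: ltW.
  rewrite (_ : (_ \o _) \o _ = k e b); first exact: integral_k.
  by apply/funext => u /=; rewrite opprK.
apply: (le_trans _ (integral_k b e0 (c0 n) (cd n))).
apply: le_ge0_integral => u; rewrite /= in_itv/= => /andP[u1 u2].
- exact: log_kernel_ge0.
- by rewrite lee_fin k_ge0// (lt_le_trans (c0 n)).
- have u0 := lt_le_trans (c0 n) u1.
  by split; [exact/andP|exact: log_kernel_le_k].
Unshelve. all: by end_near. Qed.
End log_kernel.

(** * Convexity of Newton bodies *)

Section newton_convexity.
Context {R : realType} {n : nat}.
Implicit Types (P : set 'rV[R]_n) (p q x y v : 'rV[R]_n).

Definition dot x y : R := \sum_j x 0 j * y 0 j.

Lemma dotDl x y v : dot (x + y) v = dot x v + dot y v.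
Proof.
by rewrite /dot -big_split; apply: eq_bigr => j _; rewrite mxE mulrDl.
Qed.

Lemma dotC x y : dot x y = dot y x.
Proof. by apply: eq_bigr => j _; rewrite mulrC. Qed.

Lemma dotZl (a : R) x y : dot (a *: x) y = a * dot x y.
Proof. by rewrite /dot mulr_sumr; apply: eq_bigr => j _; rewrite mxE mulrA. Qed.

Lemma dotDr x y v : dot v (x + y) = dot v x + dot v y.
Proof. by rewrite dotC dotDl !(dotC v). Qed.

Lemma dotZr (a : R) x y : dot y (a *: x) = a * dot y x.
Proof. by rewrite dotC dotZl dotC. Qed.

Lemma dotNr x y : dot x (- y) = - dot x y.
Proof. by rewrite -scaleN1r dotZr mulN1r. Qed.

Lemma dotBl x y v : dot (x - y) v = dot x v - dot y v.
Proof. by rewrite dotDl (dotC (- y)) dotNr (dotC v). Qed.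

Lemma dot_sqrDZ (a : R) x y :
  dot (x + a *: y) (x + a *: y) = dot x x + 2 * a * dot x y + a ^+ 2 * dot y y.
Proof. rewrite !(dotDl, dotDr, dotZl, dotZr) (dotC y x); ring. Qed.

Lemma dotBC x y v u : dot (x - y) (v - u) = dot (y - x) (u - v).
Proof. by rewrite -[x - y]opprB -[v - u]opprB dotNr dotC dotNr opprK dotC. Qed.

Lemma dot1 x : dot (const_mx 1) x = \sum_j x 0 j.
Proof. by apply: eq_bigr => j _; rewrite mxE mul1r. Qed.

Lemma dot_delta x j : dot (delta_mx 0 j) x = x 0 j.
Proof.
rewrite /dot (bigD1 j)//= mxE !eqxx mul1r big1 ?addr0// => i ij.
by rewrite mxE (negbTE ij) andbF mul0r.
Qed.

Lemma dotxx_ge0 x : 0 <= dot x x.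
Proof. by apply: sumr_ge0 => j _; rewrite -expr2 sqr_ge0. Qed.

Lemma dotxx_eq0 x : dot x x = 0 -> x = 0.
Proof.
move=> x0; apply/rowP => j; rewrite mxE; apply/eqP; rewrite -sqrf_eq0 expr2.
by rewrite (psumr_eq0P _ x0)// => i _; rewrite -expr2 sqr_ge0.
Qed.

Lemma continuous_sum_rV (f : 'I_n -> 'rV[R]_n -> R) :
  (forall j, continuous (f j)) -> continuous (fun x => \sum_j f j x).
Proof.
move=> cf x.
suff : forall s, \sum_(j <- s) f j y @[y --> x] --> \sum_(j <- s) f j x by exact.
elim=> [|j s ih].
  rewrite (_ : (fun y => _) = cst 0) ?big_nil; first exact: (@cst_continuous _ R 0 x).
  by apply/funext => y; rewrite big_nil.
rewrite (_ : (fun y => _) = (fun y => f j y + \sum_(i <- s) f i y)).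
  by rewrite big_cons; exact: (cvgD (cf j x) ih).
by apply/funext => y; rewrite big_cons.
Qed.

Lemma continuous_dot x : continuous (dot x).
Proof.
apply: continuous_sum_rV => j y.
exact: (cvgM (@cst_continuous _ R (x 0 j) y) (@coord_continuous _ _ _ 0 j y)).
Qed.

Lemma convex_set_rV P x y (l : R) :
  convex_set (P : set (convex_lmodType 'rV[R]_n)) -> P x -> P y ->
  0 <= l <= 1 -> P (l *: x + (1 - l) *: y).
Proof.
move=> cP Px Py /andP[l0 l1].
by have /set_mem := cP x y (Itv01 l0 l1) (mem_set Px) (mem_set Py).
Qed.

Lemma newton_convex_up P x y : newton_convex P -> P x ->
  (forall j, x 0 j <= y 0 j) -> P y.
Proof.
move=> [_ _ _ PE] Px xy; rewrite -PE; exists x => //; exists (y - x).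
  by move=> j; rewrite !mxE subr_ge0.
by rewrite addrC subrK.
Qed.

(** The hyperplane passes through the point m of P nearest to q, with normal y = q - m. *)
Lemma newton_separation P q : newton_convex P -> P !=set0 -> ~ P q ->
  exists y (b : R), [/\ forall j, y 0 j <= 0,
    forall p, P p -> dot p y <= b & b < dot q y].
Proof.
move=> Pn [p0 Pp0] nPq; have [cP convP Ppos PE] := Pn.
pose f x := dot (x - q) (x - q).
have cf : continuous f.
  apply: continuous_sum_rV => j x.
  have c : (x' - q) 0 j @[x' --> x] --> (x - q) 0 j.
    rewrite mxE (_ : (fun x' => _) = (fun x' => x' 0 j + (- q) 0 j)); last first.
      by apply/funext => x'; rewrite mxE.
    exact: (cvgD (@coord_continuous _ _ _ 0 j x) (@cst_continuous _ R _ x)).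
  exact: (cvgM c c).
(* Cutting P by a ball around q that reaches p0 makes it compact, so the squared distance f attains
   its minimum. *)
pose A := P `&` [set x | f x <= f p0].
have clA : closed A.
  apply: closedI => //.
  exact: (closed_comp (fun x _ => cf x) (@closed_le R (f p0))).
have bA : bounded_set A.
  exists (f p0 + 1 + `|q|); split; first exact: num_real.
  move=> M hM x [_ /= fx]; rewrite (le_trans _ (ltW hM))//.
  rewrite -[X in `|X|](subrK q) (le_trans (ler_normD _ _))// lerD2r.
  rewrite [leLHS]/Num.norm/= mx_normrE; apply/bigmax_leP; split.
    by rewrite addr_ge0// dotxx_ge0.
  move=> [i j] _ /=; rewrite ord1.
  have h : ((x - q) 0 j) ^+ 2 <= f p0.
    apply: le_trans fx; rewrite /f /dot (bigD1 j)//= -expr2 lerDl.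
    by apply: sumr_ge0 => k _; rewrite -expr2 sqr_ge0.
  have f0 : 0 <= f p0 by exact: dotxx_ge0.
  have := sqr_ge0 (1 - `|(x - q) 0 j|).
  rewrite sqrrB expr1n mul1r real_normK ?num_real//; lra.
have [m [Pm fm] mmin] : exists2 m, A m & forall x, A x -> f m <= f x.
  have A0 : A !=set0 by exists p0; split=> /=.
  have cA : compact A by exact: bounded_closed_compact.
  have [m mA mmin] := compact_EVT_min A0 cA (continuous_subspaceT cf).
  by exists m => [|x Ax]; [exact: set_mem|exact/mmin/mem_set].
have var p : P p -> 0 <= dot (m - q) (p - m).
  move=> Pp; rewrite leNgt; apply/negP => a0.
  pose a := - dot (m - q) (p - m); pose B := dot (p - m) (p - m).
  have a0' : 0 < a by rewrite oppr_gt0.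
  have B0 : 0 <= B by exact: dotxx_ge0.
  have aB : 0 < a + B by rewrite ltr_wpDr.
  (* For this l one has l B < a, so moving from m towards p changes f by -2 l a + l^2 B < 0, against
     minimality. *)
  pose l := a / (a + B).
  have l01 : 0 <= l <= 1.
    by rewrite divr_ge0 ?(ltW a0') ?(ltW aB)//= ler_pdivrMr// mul1r lerDl.
  have Pl : P (l *: p + (1 - l) *: m) by exact: convex_set_rV.
  have fl : f (l *: p + (1 - l) *: m) = f m - l * 2 * a + l ^+ 2 * B.
    have -> : f (l *: p + (1 - l) *: m) = dot ((m - q) + l *: (p - m)) ((m - q) + l *: (p - m)).
      rewrite /f; congr dot; apply/rowP => j; rewrite !mxE; ring.
    rewrite dot_sqrDZ -/(f m) -/B /a; ring.
  have : f m <= f (l *: p + (1 - l) *: m).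
    have [h|/ltW h] := leP (f (l *: p + (1 - l) *: m)) (f p0).
      exact: mmin.
    exact: (le_trans fm).
  rewrite fl -addrA lerDl => h.
  have l0 : 0 < l by rewrite divr_gt0.
  have : l * (a + B) = a by rewrite /l divfK// gt_eqF.
  nra.
exists (q - m), (dot m (q - m)); split.
(* The point m + e_j stays in P, which is stable under increasing coordinates; testing against it
   gives y_j <= 0. *)
- move=> j; have := var (m + delta_mx 0 j).
  rewrite addrAC subrr add0r dotC dot_delta => h.
  rewrite -oppr_ge0 (_ : - (q - m) 0 j = (m - q) 0 j); last by rewrite !mxE; ring.
  apply: h; apply: (newton_convex_up Pn Pm) => i.
  by rewrite !mxE lerDl; case: (_ && _).
- move=> p /var h; rewrite -subr_ge0.
  by rewrite -dotBl dotBC dotC.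
- rewrite -subr_gt0.
  have -> : dot q (q - m) - dot m (q - m) = f m.
    by rewrite -dotBl dotBC.
  rewrite lt_neqAle dotxx_ge0 andbT; apply/eqP => /esym/dotxx_eq0/eqP.
  by rewrite subr_eq0 => /eqP mq; apply: nPq; rewrite -mq.
Qed.

End newton_convexity.

(** * Supporting hyperplane at (1, .., 1) *)

Section supporting_hyperplane.
Context {R : realType} {n : nat}.
Implicit Types (P : set 'rV[R]_n) (p q x y : 'rV[R]_n).

(** P is stable under increasing coordinates, so one diagonal point below (1, .., 1) brings with it
    a whole cube around (1, .., 1). *)
Lemma nbhs1_newton_convex P : newton_convex P ->
  nbhs (const_mx 1 : 'rV[R]_n) P <->
  exists2 d : R, 0 < d & P (const_mx (1 - d)).
Proof.
move=> Pn; split=> [/nbhs_ballP[e /= e0 eP]|[d d0 Pd]].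
  exists (e / 2); first by rewrite divr_gt0.
  apply: eP; split=> // i j; rewrite !mxE -ball_normE /= opprB addrC subrK.
  by rewrite gtr0_norm ?divr_gt0// ltr_pdivrMr// mulr_natr mulr2n ltrDl.
apply/nbhs_ballP; exists d => //= w [_ hw].
apply: (newton_convex_up Pn Pd) => j; have := hw 0 j.
rewrite !mxE -ball_normE /= => /ltr_normlW; lra.
Qed.

(* Limit of hyperplanes separating P from the points (1 - 1/k)(1, .., 1). *)
Lemma newton_supporting_hyperplane1 P : newton_convex P -> P (const_mx 1) ->
  ~ nbhs (const_mx 1 : 'rV[R]_n) P ->
  exists alpha : 'rV[R]_n, [/\ forall j, 0 <= alpha 0 j,
    \sum_j alpha 0 j = 1 & forall p, P p -> 1 <= dot p alpha].
Proof.
move=> Pn P1 nP1.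
have sep (k : nat) : exists alpha : 'rV[R]_n, [/\ forall j, 0 <= alpha 0 j,
    \sum_j alpha 0 j = 1 & forall p, P p -> 1 - k.+1%:R^-1 <= dot p alpha].
  have k0 : 0 < k.+1%:R^-1 :> R by rewrite invr_gt0.
  have nPk : ~ P (const_mx (1 - k.+1%:R^-1)).
    by move=> Pk; apply: nP1; apply/(nbhs1_newton_convex Pn); exists k.+1%:R^-1.
  have [|y [b [y0 yb bq]]] := newton_separation Pn _ nPk; first by exists (const_mx 1).
  pose s := \sum_j y 0 j.
  have qs : dot (const_mx (1 - k.+1%:R^-1)) y = (1 - k.+1%:R^-1) * s.
    by rewrite /dot mulr_sumr; apply: eq_bigr => j _; rewrite mxE.
  have sb : s <= b by rewrite /s -dot1; exact: yb.
  (* This follows from s <= b < (1 - 1/(k + 1)) s. Dividing y by s then yields nonnegative weights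
     of sum 1. *)
  have s0 : s < 0.
    rewrite ltNge; apply/negP => /(mulr_ge0 (ltW k0)).
    move: bq; rewrite qs mulrBl mul1r; move: (_ * s) => r rs r0.
    by have := lt_le_trans (le_lt_trans sb rs); lra.
  exists (s^-1 *: y); split.
  - by move=> j; rewrite mxE mulr_le0// invr_le0 ltW.
  - rewrite (eq_bigr (fun j => s^-1 * y 0 j)); last by move=> j _; rewrite mxE.
    by rewrite -mulr_sumr mulVf// lt_eqF.
  - move=> p /yb pyb; rewrite dotZr mulrC ler_ndivlMr// mulrC.
    by rewrite mulrC -qs ltW// (le_lt_trans pyb).
pose a k := sval (cid (sep k)).
have aP k : [/\ forall j, 0 <= a k 0 j, \sum_j a k 0 j = 1 &
    forall p, P p -> 1 - k.+1%:R^-1 <= dot p (a k)].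
  by rewrite /a; case: cid.
have a1 k j : a k 0 j <= 1.
  have [a0 <- _] := aP k; rewrite (bigD1 j)//= lerDl.
  by apply: sumr_ge0 => i _.
have cK : compact [set v : 'rV[R]_n | forall i, v ord0 i \in `[0, 1]].
  by apply: (@rV_compact R n (fun=> `[0, 1]%classic)) => i; exact: segment_compact.
have [|al [al01 alcl]] := cK (a @ \oo) _.
  exists 0%N => // k _ i /=; rewrite in_itv/= a1 andbT; by have [] := aP k.
(* Closed conditions that hold eventually along the sequence pass to its cluster point [al]. *)
have lim (C : set 'rV[R]_n) : closed C -> (\forall k \near \oo, C (a k)) -> C al.
  move=> cC Ca; apply: cC => B Bal; exact: (alcl C B Ca Bal).
exists al; split.
- by move=> j; have := al01 j; rewrite /= in_itv/= => /andP[].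
- rewrite -dot1; apply: (lim [set v | dot (const_mx 1) v = 1]).
    exact: (closed_comp (fun x _ => @continuous_dot R n (const_mx 1) x) (@closed_eq R 1)).
  by apply: nearW => k /=; rewrite dot1; have [] := aP k.
- move=> p Pp; apply/ler_addgt0Pl => e e0; rewrite -lerBlDl.
  apply: (lim [set v | 1 - e <= dot p v]).
    exact: (closed_comp (fun x _ => @continuous_dot R n p x) (@closed_ge R (1 - e))).
  near=> k; rewrite /=; have [_ _ /(_ _ Pp)] := aP k; apply: le_trans.
  rewrite lerB// ltW//.
  by near: k; exact: (near_infty_natSinv_lt (PosNum e0)).
Unshelve. all: by end_near. Qed.

End supporting_hyperplane.

(** * Logarithmic coordinates *)

Section log_boxes.
Context {R : realType} {n : nat}.
Implicit Types (x y : 'rV[R]_n) (t : (n + n).-tuple R).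

Lemma expR_half2 (a : R) : expR (a / 2) ^+ 2 = expR a.
Proof. by rewrite -expRM_natl mulrC divfK. Qed.

Definition logabs2 (z : 'rV[R[i]]_n) : 'rV[R]_n := \row_j ln (cabs (z 0 j) ^+ 2).

(** Real coordinates come in two blocks, real parts then imaginary parts, as in [Cn_point]; both
    parts of z_j are sent to j. *)
Definition complex_index (i : 'I_(n + n)) : 'I_n :=
  match fintype.split i with inl j => j | inr j => j end.

Lemma complex_indexl j : complex_index (lshift n j) = j.
Proof. by rewrite /complex_index -[lshift n j]/(unsplit (inl j)) unsplitK. Qed.

Lemma complex_indexr j : complex_index (rshift n j) = j.
Proof. by rewrite /complex_index -[rshift n j]/(unsplit (inr j)) unsplitK. Qed.

Lemma prod_complex_index (F : 'I_n -> R) :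
  \prod_(i < n + n) F (complex_index i) = \prod_j F j ^+ 2.
Proof.
rewrite big_split_ord/= -big_split/=; apply: eq_bigr => j _.
by rewrite complex_indexl complex_indexr.
Qed.

(* A product of squares inside the annuli x_j - 7 <= ln |z_j|^2 < x_j. *)
Definition logbox x : set ((n + n).-tuple R) :=
  tuple_box (fun i => `](expR (x 0 (complex_index i) / 2) / 4),
                        (expR (x 0 (complex_index i) / 2) / 2)[%classic).

Lemma measurable_logbox x : measurable (logbox x).
Proof. by apply: measurable_tuple_box => i; exact: measurable_itv. Qed.

(** Each z_j ranges over a square of side e^{x_j/2}/4; the factor exp(sum x) is the Jacobian of the
    logarithmic coordinates. *)
Lemma logbox_measure x :
  lebesgueC n (logbox x) = (expR (\sum_j x 0 j) / 16 ^+ n)%:E.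
Proof.
rewrite /lebesgueC power_measure_box; last by move=> i; exact: measurable_itv.
transitivity (\prod_(i < n + n) (expR (x 0 (complex_index i) / 2) / 4)%:E)%E.
  apply: eq_bigr => i _; apply: (etrans (lebesgue_measure_itv _)).
  rewrite /= lte_fin.
  have h := expR_gt0 (x 0 (complex_index i) / 2).
  rewrite ifT; last by lra.
  by rewrite -EFinB; congr EFin; field.
rewrite prodEFin; congr EFin.
rewrite (prod_complex_index (fun j => expR (x 0 j / 2) / 4)).
rewrite expR_sum -exprVn -[X in _ ^+ X](card_ord n) -prodr_const -big_split/=.
apply: eq_bigr => j _; rewrite exprMn expR_half2 exprVn; congr (_ / _).
by rewrite -natrX.
Qed.

Lemma logboxP x t j : logbox x t ->
  [/\ expR (x 0 j / 2) / 4 < complex.Re (Cn_point t 0 j) < expR (x 0 j / 2) / 2 &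
      expR (x 0 j / 2) / 4 < complex.Im (Cn_point t 0 j) < expR (x 0 j / 2) / 2].
Proof.
move=> tx; have := tx (lshift n j); have := tx (rshift n j).
by rewrite /= complex_indexl complex_indexr Re_Cn_point Im_Cn_point !in_itv.
Qed.

Lemma cabs_sqr (z : R[i]) : cabs z ^+ 2 = complex.Re z ^+ 2 + complex.Im z ^+ 2.
Proof. by rewrite cabsE sqr_sqrtr// addr_ge0// sqr_ge0. Qed.

Lemma logbox_cabs x t j : logbox x t ->
  expR (x 0 j) / 8 < cabs (Cn_point t 0 j) ^+ 2 < expR (x 0 j) / 2.
Proof.
move=> /(logboxP j)[]; rewrite cabs_sqr -(expR_half2 (x 0 j)).
have := expR_gt0 (x 0 j / 2); move: (expR _) => r r0 /andP[u1 u2] /andP[v1 v2].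
by apply/andP; split; nra.
Qed.

Lemma logbox_neq0 x t j : logbox x t -> Cn_point t 0 j != 0.
Proof.
move=> /(logbox_cabs j)/andP[h _]; apply/eqP => z0; move: h.
rewrite z0 cabs0 expr0n/= ltNge divr_ge0// expR_ge0//.
Qed.

Lemma logbox_polydisc x t : (forall j, x 0 j <= 0) -> logbox x t ->
  polydisc (Cn_point t).
Proof.
move=> x0 xt j; have /andP[_ h] := logbox_cabs j xt.
have : cabs (Cn_point t 0 j) ^+ 2 < 1 ^+ 2.
  rewrite expr1n (lt_le_trans h)//.
  have : expR (x 0 j) <= 1 by rewrite -expR0 ler_expR.
  lra.
by rewrite ltr_pXn2r// ?nnegrE// cabsE sqrtr_ge0.
Qed.

Lemma logbox_logabs2 x t j : logbox x t ->
  x 0 j - 7 <= logabs2 (Cn_point t) 0 j < x 0 j.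
Proof.
move=> /(logbox_cabs j)/andP[h1 h2]; rewrite mxE.
have c0 : 0 < cabs (Cn_point t 0 j) ^+ 2.
  by apply: lt_trans h1; rewrite divr_gt0// expR_gt0.
apply/andP; split; last first.
  rewrite -ltr_expR lnK ?posrE// (lt_le_trans h2)//.
  by have := expR_gt0 (x 0 j); lra.
rewrite -ler_expR lnK ?posrE// (le_trans _ (ltW h1))// expRB.
(* The width 7 of the boxes in logarithmic coordinates comes from here: 1 + 7 <= e^7. *)
have h7 : 8 <= expR 7 :> R.
  by apply: le_trans (expR_ge1Dx 7); rewrite -natr1 addrC.
by rewrite ler_wpM2l ?expR_ge0// lef_pV2 ?posrE// expR_gt0.
Qed.

Lemma logbox_disjoint x y j : x 0 j <= y 0 j - 7 -> logbox x `&` logbox y = set0.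
Proof.
move=> xy; rewrite -subset0 => t [xt yt].
have /andP[_ h1] := logbox_logabs2 j xt; have /andP[h2 _] := logbox_logabs2 j yt.
by have := lt_le_trans h1 (le_trans xy h2); rewrite ltxx.
Qed.

End log_boxes.

(** * Bounds on toric profiles and polar majorants *)

Section toric_bounds.
Context {R : realType} {n : nat}.
Implicit Types (x a p : 'rV[R]_n) (t : (n + n).-tuple R).

(** The bounded difference between g and the support function is recast as two inequalities between
    real numbers with one constant C. *)
Lemma newton_body_bounds (Psi : 'rV[R[i]]_n -> \bar R) (P : set 'rV[R]_n) :
  newton_body_of Psi P -> [/\ newton_convex P, P !=set0 & exists g (C : R),
  [/\ 0 <= C, toric_profile Psi g,
    forall x p, neg_orthant x -> P p -> dot p x <= g x + C &
    forall x (H : R), neg_orthant x -> (forall p, P p -> dot p x <= H) ->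
      g x <= H + C]].
Proof.
move=> [Pn [g [gP]]].
set S := ereal_sup _ => Soo.
have S_ge x : neg_orthant x -> (`|(g x)%:E - support_fun P x| <= S)%E.
  by move=> x0; apply: ereal_sup_ubound; exists x.
have neg1 : neg_orthant (const_mx (-1) : 'rV[R]_n) by move=> j; rewrite mxE ltrN10.
have S0 : (0 <= S)%E by exact: le_trans (S_ge _ neg1).
have [C SC] : exists C, S = C%:E.
  by exists (fine S); rewrite fineK// ge0_fin_numE.
have supp x : neg_orthant x -> exists h, support_fun P x = h%:E /\ `|g x - h| <= C.
  move=> /S_ge; rewrite SC; case: support_fun => [h| |]//=; rewrite ?leye_eq//.
  by rewrite lee_fin => hC; exists h.
split=> //.
  (* The support function of the empty set is -oo, which is not within a finite distance of g. *)
  apply/set0P/negP => /eqP P0; have [h [+ _]] := supp _ neg1.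
  by rewrite /support_fun P0 image_set0 ereal_sup0.
exists g, C; split=> //; first by rewrite -lee_fin -SC.
- move=> x p x0 Pp; have [h [hE gh]] := supp _ x0.
  have : ((dot p x)%:E <= h%:E)%E by rewrite -hE; apply: ereal_sup_ubound; exists p.
  by rewrite lee_fin; move: gh; rewrite ler_norml => /andP[]; lra.
- move=> x H x0 pH; have [h [hE gh]] := supp _ x0.
  have : (h%:E <= H%:E)%E.
    by rewrite -hE; apply: ge_ereal_sup => _ [p Pp <-]; rewrite lee_fin; exact: pH.
  by rewrite lee_fin; move: gh; rewrite ler_norml => /andP[]; lra.
Qed.

Lemma logbox_neg_orthant x t : (forall j, x 0 j <= 0) -> logbox x t ->
  neg_orthant (logabs2 (Cn_point t)).
Proof.
by move=> x0 xt j; have /andP[_ h] := logbox_logabs2 j xt; exact: lt_le_trans h _.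
Qed.

Lemma polydisc_neg_orthant (z : 'rV[R[i]]_n) : polydisc z ->
  (forall j, z 0 j != 0) -> neg_orthant (logabs2 z).
Proof.
move=> z1 z0 j; rewrite mxE; apply: ln_lt0.
have c0 : 0 < cabs (z 0 j) by rewrite -ltcR -normC_cabs normr_gt0.
by rewrite exprn_gt0//= expr_lt1// ltW.
Qed.

Lemma dot_logbox_le x t p : (forall j, 0 <= p 0 j) -> logbox x t ->
  dot p (logabs2 (Cn_point t)) <= dot p x.
Proof.
move=> p0 xt; apply: ler_sum => j _; rewrite ler_wpM2l//.
by have /andP[_ /ltW] := logbox_logabs2 j xt.
Qed.

Lemma dot1_logbox_ge x t : logbox x t ->
  \sum_j x 0 j - 7 * n%:R <= dot (const_mx 1) (logabs2 (Cn_point t)).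
Proof.
move=> xt; rewrite dot1 mulr_natr -[X in _ *+ X](card_ord n) -sumr_const -sumrB.
by apply: ler_sum => j _; have /andP[] := logbox_logabs2 j xt.
Qed.

Lemma small_logbox (r : R) : 0 < r -> exists2 s, 0 <= s &
  forall x t, (forall j, x 0 j <= - s) -> logbox x t ->
    forall j, cabs (Cn_point t 0 j) < r.
Proof.
move=> r0; exists `|ln (r ^+ 2)|; first by [].
move=> x t xs xt j; have /andP[_ h] := logbox_cabs j xt.
have r20 : 0 < r ^+ 2 by rewrite exprn_gt0.
have : cabs (Cn_point t 0 j) ^+ 2 < r ^+ 2.
  apply: (lt_le_trans h).
  have : expR (x 0 j) <= r ^+ 2.
    rewrite -[leRHS]lnK ?posrE// ler_expR (le_trans (xs j))// lerNl.
    by rewrite -normrN ler_norm.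
  by have := expR_gt0 (x 0 j); lra.
by rewrite ltr_pXn2r// ?nnegrE ?(ltW r0)// cabsE sqrtr_ge0.
Qed.

(** Both real coordinates of z_j are centred at a_j/2, since ln |Re z_j| and ln |Im z_j| are
    compared with half of ln |z_j|^2. *)
Definition polar_kernel (e : R) a t : \bar R :=
  (\prod_(i < n + n) log_kernel e (a 0 (complex_index i) / 2)%R (tnth t i))%E.

Lemma polar_kernel_ge0 e a t : (0 <= polar_kernel e a t)%E.
Proof. by apply: prode_ge0 => i _; exact: log_kernel_ge0. Qed.

Lemma measurable_polar_kernel e a :
  measurable_fun [set: (n + n).-tuple (measurableTypeR R)] (polar_kernel e a).
Proof.
apply: (@measurable_prod_tnth R _ (measurableTypeR R) (n + n)
  (fun i => log_kernel e (a 0 (complex_index i) / 2))) => i.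
exact: measurable_log_kernel.
Qed.

Lemma integral_polar_kernel e a : 0 < e ->
  (\int[lebesgueC n]_t polar_kernel e a t <= ((2 * pi / e) ^+ (n + n))%:E)%E.
Proof.
move=> e0; rewrite /lebesgueC.
rewrite (@integral_power_measure_prod R _ (measurableTypeR R) _ (n + n)
  (fun i => log_kernel e (a 0 (complex_index i) / 2))); last 2 first.
- by move=> i; exact: measurable_log_kernel.
- by move=> i u; exact: log_kernel_ge0.
rewrite -[X in _ ^+ X](card_ord (n + n)) -prodr_const -prodEFin.
suff : forall s : seq 'I_(n + n),
    (0 <= \prod_(i <- s) \int[lebesgue_measure]_u
        log_kernel e (a 0 (complex_index i) / 2)%R u <=
      \prod_(i <- s) (2 * pi / e)%:E)%E.
  by move=> /(_ (index_enum _))/andP[].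
elim=> [|i s /andP[ih0 ih]]; first by rewrite !big_nil lexx lee01.
have k0 : (0 <= \int[lebesgue_measure]_u log_kernel e (a 0 (complex_index i) / 2)%R u)%E.
  by apply: integral_ge0 => u _; exact: log_kernel_ge0.
by rewrite !big_cons mule_ge0//= lee_pmul// integral_log_kernel.
Qed.

(** Where a real coordinate vanishes the kernel dominates any integrand, so comparisons only concern
    the other points. *)
Lemma polar_kernel_eqy e a t : (exists i, tnth t i = 0) ->
  polar_kernel e a t = +oo%E.
Proof.
move=> [i ti]; rewrite /polar_kernel (bigD1 i)//= {1}/log_kernel ti eqxx.
rewrite gt0_mulye//.
elim/big_ind : _ => // [u v|k _]; first exact: mule_gt0.
by rewrite /log_kernel; case: ifP => // _; rewrite lte_fin expR_gt0.
Qed.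

(* y |-> - y - e |y - a| is nonincreasing for e <= 1, hence its value at
   ln |z|^2 is at most the mean of its values at 2 ln |Re z| and 2 ln |Im z|. *)
Lemma polar_kernel_ge e a t : 0 < e <= 1 -> (forall i, tnth t i != 0) ->
  ((expR (\sum_j (- logabs2 (Cn_point t) 0 j
                  - e * `|logabs2 (Cn_point t) 0 j - a 0 j|)))%:E
    <= polar_kernel e a t)%E.
Proof.
move=> /andP[e0 e1] t0.
pose psi (b y : R) := - y - e * `|y - b|.
have psi_dec (b y1 y2 : R) : y1 <= y2 -> psi b y2 <= psi b y1.
  move=> y12; rewrite /psi.
  have h1 := ler_distD y2 y1 b.
  have h2 : `|y1 - y2| = y2 - y1 by rewrite distrC ger0_norm ?subr_ge0.
  by move: h1; rewrite h2; move: (`|y1 - b|) (`|y2 - b|) => A B h1; nra.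
have -> : polar_kernel e a t =
    (expR (\sum_(i < n + n) psi (a 0 (complex_index i)) (2 * ln `|tnth t i|) / 2))%:E.
  rewrite expR_sum -prodEFin; apply: eq_bigr => i _.
  rewrite /log_kernel (negbTE (t0 i)) /psi; congr (expR _)%:E.
  rewrite (_ : 2 * ln _ - _ = 2 * (ln `|tnth t i| - a 0 (complex_index i) / 2)); last by field.
  by rewrite normrM ger0_norm//; field.
rewrite lee_fin ler_expR big_split_ord/= -big_split/=.
apply: ler_sum => j _; rewrite complex_indexl complex_indexr -/(psi (a 0 j) _).
rewrite mxE.
have h i : tnth t i ^+ 2 <= cabs (Cn_point t 0 j) ^+ 2 ->
    2 * ln `|tnth t i| <= ln (cabs (Cn_point t 0 j) ^+ 2).
  move=> hi.
  have t20 : 0 < tnth t i ^+ 2 by rewrite exprn_even_gt0//= t0.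
  rewrite mulr_natl -lnXn ?normr_gt0// real_normK ?num_real//.
  by rewrite ler_ln ?posrE// (lt_le_trans t20).
have h1 := psi_dec (a 0 j) _ _ (h (lshift n j) _).
have h2 := psi_dec (a 0 j) _ _ (h (rshift n j) _).
rewrite cabs_sqr Re_Cn_point Im_Cn_point in h1 h2 *.
have {}h1 := h1 _; have {}h2 := h2 _.
apply: le_trans (lerD (ler_wpM2r _ (h1 _)) (ler_wpM2r _ (h2 _))); rewrite ?invr_ge0//.
- by rewrite -splitr.
- by rewrite lerDl sqr_ge0.
- by rewrite lerDr sqr_ge0.
Qed.

(** The bound is uniform in the centre a: it serves with a = 0 for the log canonical threshold, and
    with a moving along a ray for the Ohsawa norm. *)
Lemma toric_integral_le (D : set ((n + n).-tuple R))
    (f : (n + n).-tuple R -> \bar R) (e c : R) a :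
  0 < e <= 1 -> 0 < c -> (forall t, D t -> 0 <= f t)%E ->
  (forall t, D t -> (forall j, Cn_point t 0%R j != 0%R) ->
    f t <= (c * expR (\sum_j (- logabs2 (Cn_point t) 0 j
                  - e * `|logabs2 (Cn_point t) 0 j - a 0 j|))%R)%:E)%E ->
  (\int[lebesgueC n]_(t in D) f t <= (c * (2 * pi / e) ^+ (n + n))%:E)%E.
Proof.
move=> /[dup] e01 /andP[e0 e1] c0 f0 fc.
apply: (@le_trans _ _ (\int[lebesgueC n]_t (c%:E * polar_kernel e a t))%E).
  apply: le_ge0_integral => // [t _|t Dt].
    by rewrite mule_ge0 ?polar_kernel_ge0// lee_fin ltW.
  split=> //; have [t0|] := pselect (forall i, tnth t i != 0).
    apply: (le_trans (fc _ Dt _)); last first.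
      by rewrite EFinM lee_pmul2l// polar_kernel_ge.
    move=> j; apply/eqP => zj; have := t0 (lshift n j).
    by rewrite -Re_Cn_point zj eqxx.
  move=> /existsNP[i /negP]; rewrite negbK => /eqP ti.
  by rewrite polar_kernel_eqy ?gt0_muley ?leey//; exists i.
rewrite ge0_integralZl//; last 3 first.
- exact: measurable_polar_kernel.
- by move=> t _; exact: polar_kernel_ge0.
- by rewrite lee_fin ltW.
by rewrite EFinM lee_pmul2l// integral_polar_kernel.
Qed.

End toric_bounds.

Lemma measurable_expeR (R : realType) :
  measurable_fun [set: \bar R] (@expeR R).
Proof.
apply: (measurability _ (ErealGenInftyO.measurableE R)).
move=> _ [_ [a ->] <-]; rewrite setTI.
have [a0|a0] := leP a 0.
  rewrite (_ : _ @^-1` _ = set0)//; rewrite -subset0 => x /=.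
  by rewrite in_itv/= ltNge (le_trans _ (expeR_ge0 x)).
rewrite (_ : _ @^-1` _ = `]-oo, (ln a)%:E[%classic); first exact: emeasurable_itv.
apply/seteqP; split=> -[x| |]//=; rewrite !in_itv/= ?lte_fin ?ltNyr//.
- by move=> xa; rewrite -ltr_expR lnK.
- by rewrite -[in X in _ -> X](@lnK _ a) ?posrE// ltr_expR.
Qed.

(** * Log canonical threshold and Ohsawa norm *)

Section toric_ohsawa_norm.
Context {R : realType} {n : nat}.
Implicit Types (x y p : 'rV[R]_n) (w : 'rV[R[i]]_n) (t : (n + n).-tuple R).
Variables (Psi : 'rV[R[i]]_n -> \bar R) (P : set 'rV[R]_n).
Variables (g : 'rV[R]_n -> R) (C : R).
Hypothesis n0 : (0 < n)%N.
Hypothesis Psi_psh : psh_on (@polydisc R n) Psi.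
Hypothesis Pn : newton_convex P.
Hypothesis P0 : P !=set0.
Hypothesis C0 : 0 <= C.
Hypothesis Psig : toric_profile Psi g.
Hypothesis g_ge : forall x p, neg_orthant x -> P p -> dot p x <= g x + C.
Hypothesis g_le : forall x (H : R), neg_orthant x ->
  (forall p, P p -> dot p x <= H) -> g x <= H + C.
Hypothesis Psi_lct : lct0 Psi = 1%E.

Let P_ge0 p : P p -> forall j, 0 <= p 0 j.
Proof. by case: Pn => _ _ sP _ /sP. Qed.

Lemma Psi_logbox x t : (forall j, x 0 j <= 0) -> logbox x t ->
  Psi (Cn_point t) = (g (logabs2 (Cn_point t)))%:E.
Proof.
move=> x0 xt; apply: Psig; first exact: logbox_polydisc xt.
by move=> j; exact: logbox_neq0 xt.
Qed.

Lemma g_logbox_le x t (H : R) : (forall j, x 0 j <= 0) -> logbox x t ->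
  (forall p, P p -> dot p x <= H) -> g (logabs2 (Cn_point t)) <= H + C.
Proof.
move=> x0 xt pH; apply: g_le; first exact: logbox_neg_orthant xt.
move=> p Pp; apply: le_trans (pH _ Pp).
by apply: dot_logbox_le => //; exact: P_ge0.
Qed.

(** Otherwise (1/c, .., 1/c) lies outside P for an integrable exponent c close to 1. Along a
    separating direction y, the boxes near T y contribute at least a multiple of e^{T (s - c b)} to
    the integral of e^{-c Psi}, with s - c b > 0; this is unbounded in T. *)
Lemma lct0_newton_mem1 : P (const_mx 1).
Proof.
apply: contrapT => nP1.
have [e e0 eP] : exists2 e : R, 0 < e & forall d, `|d| < e -> ~ P (const_mx (1 + d)).
  have /nbhs_ballP[e /= e0 eP] : nbhs (const_mx 1 : 'rV[R]_n) (~` P).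
    apply: open_nbhs_nbhs; split=> //; rewrite openC.
    by case: Pn.
  exists e => // d de; apply: eP; split=> // i j.
  by rewrite !mxE -ball_normE /= opprD addrA subrr add0r normrN.
(* An exponent c between 1/(1 + e) and 1 satisfies 0 <= 1/c - 1 < e, so that [eP] applies to it. *)
have : ((1 + e)^-1%:E < lct0 Psi)%E by rewrite Psi_lct lte_fin invf_lt1 ?ltrDl// addr_gt0.
move=> /ereal_sup_gt[_ [c [c0 [U [U0 UD Uint]]] <-]]; rewrite lte_fin => ec.
have c1 : c <= 1.
  rewrite -lee_fin -Psi_lct; apply: ereal_sup_ubound; exists c => //.
  by split=> //; exists U.
have {}c0 : 0 < c by apply: lt_trans ec; rewrite invr_gt0 addr_gt0.
have nPc : ~ P (const_mx c^-1).
  rewrite (_ : c^-1 = 1 + (c^-1 - 1)); last by rewrite addrC subrK.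
  apply: eP; rewrite ger0_norm ?subr_ge0 ?invf_ge1//.
  rewrite ltrBlDl -[ltRHS]invrK ltf_pV2 ?posrE ?invr_gt0//.
  exact: addr_gt0.
have [y [b [y0 yb bq]]] := newton_separation Pn P0 nPc.
pose s := \sum_j y 0 j.
have {}bq : c * b < s.
  have : dot (const_mx c^-1) y = c^-1 * s.
    by rewrite /dot mulr_sumr; apply: eq_bigr => j _; rewrite mxE.
  by move: bq => /[swap] ->; rewrite mulrC ltr_pdivlMr// mulrC.
have [r r0 rU] : exists2 r : R, 0 < r & forall w, (forall j, cabs (w 0 j) < r) -> U w.
  have /nbhsC_cabs[r r0 rU] : nbhs (0 : 'rV[R[i]]_n) U by exact: open_nbhs_nbhs.
  exists r => // w wr; apply: rU => j.
  by rewrite mxE sub0r /cabs normrN; exact: wr.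
have [S S0 Sbox] := @small_logbox R n _ r0.
have /integrableP[_] := Uint.
set I := (\int[_]_(t in _) _)%E => Ioo.
have I0 : (0 <= I)%E by apply: integral_ge0 => t _; exact: abse_ge0.
have [M IM] : exists M, I = M%:E.
  by exists (fine I); rewrite fineK// ge0_fin_numE.
pose k : R := expR (- c * C - n%:R * S) / 16 ^+ n.
have k0 : 0 < k by rewrite divr_gt0 ?expR_gt0// exprn_gt0.
have bound (T : R) : 0 <= T -> k * expR (T * (s - c * b)) <= M.
  (* The shift by -S brings the box into U; its cost is the constant factor e^{-n S} in [k]. *)
  move=> T0; pose x := T *: y + const_mx (- S).
  have xS j : x 0 j <= - S.
    by rewrite !mxE gerDr mulr_ge0_le0.
  have x0 j : x 0 j <= 0 by apply: le_trans (xS j) _; rewrite oppr_le0.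
  have sx : \sum_j x 0 j = T * s - n%:R * S.
    rewrite mulr_sumr; under eq_bigr do rewrite !mxE.
    by rewrite big_split/= sumr_const card_ord mulNrn mulr_natl.
  have px p : P p -> dot p x <= T * b.
    move=> Pp; rewrite dotDr dotZr -[leRHS]addr0 lerD//.
      by rewrite ler_wpM2l// yb.
    by apply: sumr_le0 => j _; rewrite mxE mulr_ge0_le0 ?oppr_le0// P_ge0.
  have : ((expR (- (c * (T * b + C))))%:E * lebesgueC n (logbox x) <= I)%E.
    apply: ge0_integral_ge_cst.
    - exact: measurable_logbox.
    - exact: expR_ge0.
    - by move=> t _; exact: abse_ge0.
    - move=> t xt; split; first by apply: rU => j; exact: Sbox xt _.
      rewrite /= (Psi_logbox x0 xt)/= ger0_norm ?expR_ge0// lee_fin ler_expR lerN2.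
      by rewrite ler_wpM2l ?(ltW c0)// (g_logbox_le x0 xt).
  rewrite logbox_measure -EFinM IM lee_fin; apply: le_trans.
  rewrite /k mulrA -expRD mulrAC -expRD sx ler_wpM2r ?invr_ge0 ?exprn_ge0//.
  by rewrite ler_expR le_eqVlt; apply/orP; left; apply/eqP; ring.
clearbody k; have d0 : 0 < s - c * b by rewrite subr_gt0.
have M0 : 0 < M.
  by apply: lt_le_trans (bound 0 (lexx _)); rewrite mul0r expR0 mulr1.
(* At this T the inequality 1 + v <= e^v already makes the left side of [bound] at least k + M >
   M. *)
have T0 : 0 <= M / (k * (s - c * b)).
  by apply: divr_ge0; [exact: ltW|apply: mulr_ge0; exact: ltW].
have := bound _ T0; apply/negP; rewrite -ltNge.
rewrite mulrC -ltr_pdivrMr//.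
apply: (@lt_le_trans _ _ (1 + M / (k * (s - c * b)) * (s - c * b))); last exact: expR_ge1Dx.
by rewrite invfM mulrA divfK ?gt_eqF// ltrDr.
Qed.

(** If (1 - d, .., 1 - d) were in P, then g x >= (1 - d) sum x - C, and e^{-(1 + d) Psi} would be at
    most a constant times exp(-(1 - d^2) sum x). This is integrable on the polydisc, so the
    threshold would be at least 1 + d. *)
Lemma lct0_newton_nbhs1 : ~ nbhs (const_mx 1 : 'rV[R]_n) P.
Proof.
move=> /(nbhs1_newton_convex Pn)[d d0 Pd].
(* P lies in the nonnegative orthant and there is at least one coordinate; hence d^2 <= 1 is an
   admissible rate for the kernel. *)
have d1 : d <= 1 by have := P_ge0 Pd (Ordinal n0); rewrite mxE subr_ge0.
have D0 : open (@polydisc R n) := @open_polydisc R n.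
have [_ Psi_usc _] := Psi_psh.
suff : ((1 + d)%:E <= lct0 Psi)%E by rewrite Psi_lct lee_fin gerDl leNgt d0.
apply: ereal_sup_ubound; exists (1 + d) => //; split; first by rewrite addr_ge0// ltW.
exists (@polydisc R n); split=> //.
  by split=> // j; rewrite mxE cabs0.
have mf : measurable_fun (@Cn_point R n @^-1` @polydisc R n)
    ((fun z => expeR (- ((1 + d)%:E * Psi z))%E) \o @Cn_point R n).
  apply: (measurableT_comp (@measurable_expeR R)).
  apply: measurableT_comp => //; apply: measurable_funeM.
  exact: measurable_fun_usc.
apply/integrableP; split=> //.
apply: (@le_lt_trans _ _ (expR ((1 + d) * C) * (2 * pi / d ^+ 2) ^+ (n + n))%:E); last exact: ltry.
apply: (@toric_integral_le R n _ _ _ _ 0).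
- by rewrite exprn_gt0//= expr_le1// ltW.
- exact: expR_gt0.
- by move=> t _; exact: abse_ge0.
- move=> t Dt t0; rewrite /= (Psig Dt t0)/= -/(logabs2 _) ger0_norm ?expR_ge0// lee_fin -expRD ler_expR.
  set x := logabs2 _.
  have x0 : neg_orthant x by exact: polydisc_neg_orthant.
  clearbody x; have := g_ge x0 Pd.
  have -> : dot (const_mx (1 - d)) x = (1 - d) * \sum_j x 0 j.
    by rewrite /dot mulr_sumr; apply: eq_bigr => j _; rewrite mxE.
  (* All x_j are negative, so |x_j| = -x_j and the kernel centred at 0 has exactly the desired
     exponent. *)
  have -> : \sum_j (- x 0 j - d ^+ 2 * `|x 0 j - (0 : 'rV[R]_n) 0 j|) =
      - (1 - d ^+ 2) * \sum_j x 0 j.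
    rewrite mulr_sumr; apply: eq_bigr => j _.
    rewrite mxE subr0 ltr0_norm//; ring.
  move: (\sum_j x 0 j) (g x) => S G h.
  rewrite -subr_ge0 (_ : _ - _ = (1 + d) * (G + C - (1 - d) * S)); last by ring.
  by rewrite mulr_ge0 ?subr_ge0// addr_ge0// ltW.
Qed.

(* With s = sum x and Delta = g x - s + C, the points 1 +- eps (e_i - alpha_i 1)
   of P give eps |x_i - alpha_i s| <= Delta, while |s - T| <= Delta + C + 1. *)
Lemma locally_hyperplane1_decay (r : R) (alpha : 'rV[R]_n) : 0 < r ->
  (forall j, 0 <= alpha 0 j) -> \sum_j alpha 0 j = 1 ->
  (forall v, dot v v < r ^+ 2 -> 0 <= dot alpha v -> P (const_mx 1 + v)) ->
  exists2 e : R, 0 < e <= 1 & forall x (T : R), neg_orthant x ->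
    T < g x < T + 1 -> - g x <= 2 * C + 1 +
      \sum_j (- x 0 j - e * `|x 0 j - (T *: alpha) 0 j|).
Proof.
move=> r0 a0 a1 aP.
have nR0 : 0 < n%:R :> R by rewrite ltr0n.
have nR1 : 1 <= n%:R :> R by rewrite ler1n.
(* Vectors with coordinates bounded by eps are then shorter than r, as n eps^2 < r^2. *)
pose eps := r / (n%:R + 1).
have eps0 : 0 < eps by rewrite divr_gt0// addr_gt0.
(* The factor eps/(1 + eps) pays for replacing s by T in the deviation bound, and 1/n for summing
   over the coordinates. *)
pose e := eps / (1 + eps) / n%:R.
have e0 : 0 < e by rewrite !divr_gt0// addr_gt0.
exists e.
  rewrite e0/= ler_pdivrMr// mul1r (le_trans _ nR1)//.
  by rewrite ler_pdivrMr ?addr_gt0// mul1r lerDr.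
move=> x T x0 /andP[Tg gT].
pose s := \sum_j x 0 j; pose D := g x - s + C.
have dotP v : dot v v < r ^+ 2 -> 0 <= dot alpha v -> dot v x <= D.
  move=> vr av; have := g_ge x0 (aP v vr av).
  by rewrite dotDl dot1 -/s /D; lra.
have dot0 y : dot 0 y = 0 by rewrite /dot big1// => j _; rewrite mxE mul0r.
have D0 : 0 <= D by rewrite -(dot0 x); apply: dotP; rewrite ?dot0 ?exprn_gt0// dotC dot0.
have a_le1 i : alpha 0 i <= 1.
  by rewrite -a1 (bigD1 i)//= lerDl sumr_ge0.
have dev i : eps * `|x 0 i - alpha 0 i * s| <= D.
  pose v := delta_mx 0 i - alpha 0 i *: const_mx 1 : 'rV[R]_n.
  have vle j : `|v 0 j| <= 1.
    rewrite !mxE mulr1 eqxx/=; have := a0 i; have := a_le1 i.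
    by case: eqP => _ /=; rewrite ler_norml => *; apply/andP; split; lra.
  have vv (c : R) : `|c| = eps -> dot (c *: v) (c *: v) < r ^+ 2.
    move=> ce; rewrite dotZl dotZr mulrA -expr2 -real_normK ?num_real// ce.
    apply: (@le_lt_trans _ _ (eps ^+ 2 * n%:R)).
      rewrite ler_wpM2l ?sqr_ge0// -[X in _ <= X%:R](card_ord n) -sumr_const.
      apply: ler_sum => j _; rewrite -expr2 -real_normK ?num_real//.
      by rewrite expr_le1.
    rewrite /eps expr_div_n -mulrA gtr_pMr ?exprn_gt0// mulrC.
    rewrite ltr_pdivrMr ?exprn_gt0 ?addr_gt0// mul1r; nra.
  have av (c : R) : dot alpha (c *: v) = 0.
    rewrite dotZr dotDr dotNr dotZr (dotC _ (delta_mx _ _)) dot_delta.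
    by rewrite (dotC _ (const_mx 1)) dot1 a1 mulr1 subrr mulr0.
  have vx (c : R) : dot (c *: v) x = c * (x 0 i - alpha 0 i * s).
    by rewrite dotZl dotBl dotZl dot_delta dot1.
  have [h|h] := leP 0 (x 0 i - alpha 0 i * s).
    by rewrite ger0_norm// -vx dotP ?av// vv// gtr0_norm.
  by rewrite ltr0_norm// mulrN -mulNr -vx dotP ?av// vv// normrN gtr0_norm.
have sT : `|s - T| <= D + C + 1.
  have -> : s = g x + C - D by rewrite /D; ring.
  move: (D) D0 (g x) Tg gT => D' D'0 G TG GT.
  by rewrite ler_norml; have := C0 => ?; apply/andP; split; lra.
have devT i : e * n%:R * `|x 0 i - (T *: alpha) 0 i| <= D + C + 1.
  rewrite /e divfK ?gt_eqF// mulrAC ler_pdivrMr ?addr_gt0//.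
  have h1 : `|x 0 i - (T *: alpha) 0 i| <= `|x 0 i - alpha 0 i * s| + (D + C + 1).
    rewrite mxE; apply: (le_trans (ler_distD (alpha 0 i * s) _ _)).
    rewrite lerD2l (mulrC T) -mulrBr normrM ger0_norm//.
    by apply: le_trans sT; rewrite ler_piMl.
  have h2 := dev i; have := ler_wpM2l (ltW eps0) h1.
  by rewrite mulrDr => h3; apply: (le_trans h3); rewrite mulrDr mulr1; have := C0; lra.
have sumT : e * \sum_i `|x 0 i - (T *: alpha) 0 i| <= D + C + 1.
  rewrite -(ler_pM2r nR0) mulrAC mulr_sumr.
  rewrite [leRHS]mulr_natr -[X in _ <= _ *+ X](card_ord n) -sumr_const.
  exact: ler_sum.
(* Since D + C + 1 = g x - s + 2 C + 1, the sum s cancels. *)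
rewrite big_split/= !sumrN -mulr_sumr -/s.
by move: sumT; rewrite /D; lra.
Qed.

(** The constant form 1 on the polydisc has finite norm: on each window T < Psi < T + 1 the
    integrand is dominated by the kernel centred at T alpha, whose integral is bounded independently
    of T. *)
Lemma locally_hyperplane1_not_singular :
  locally_hyperplane1 P -> ~ ohsawa_singular Psi 0.
Proof.
move=> [r [r0 [alpha [a0 a1 aP]]]].
have aP' v : dot v v < r ^+ 2 -> 0 <= dot alpha v -> P (const_mx 1 + v).
  move=> vr av.
  have vj j : (const_mx 1 + v) 0 j - 1 = v 0 j by rewrite !mxE addrC addKr.
  suff : (P `&` [set x | \sum_j (x 0 j - 1) ^+ 2 < r ^+ 2]) (const_mx 1 + v) by case.
  rewrite -aP /=; split.
    by under eq_bigr do rewrite vj expr2.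
  by under eq_bigr do rewrite vj.
have [e e01 eg] := locally_hyperplane1_decay r0 a0 a1 aP'.
move=> /(_ (@polydisc R n) (fun=> 1)) h.
have : ohsawa_norm Psi (@polydisc R n) (fun=> 1) = +oo%E.
  apply: h => //.
  - by split; [exact: open_polydisc|move=> j; rewrite mxE cabs0].
  - by apply: continuous_subspaceT; exact: cst_continuous.
suff : (ohsawa_norm Psi (@polydisc R n) (fun=> 1%R) <=
    (expR (2 * C + 1) * (2 * pi / e) ^+ (n + n))%:E)%E.
  by move=> /[swap] ->; rewrite leye_eq.
apply: ge_ereal_sup => _ [K [_ KD] <-].
apply: (@le_trans _ _ (ereal_sup ((fun T : R =>
      integralC ([set z | (T%:E < Psi z < (T + 1)%:E)%E] `&` K)
        (fun z => 1%:E * expeR (- Psi z))%E) @` setT))).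
  by apply: ereal_inf_lbound; exists setT => //; exact: filterT.
apply: ge_ereal_sup => _ [T _ <-]; rewrite /integralC.
apply: (@toric_integral_le R n _ _ _ _ (T *: alpha)) => //.
- exact: expR_gt0.
- by move=> t _; rewrite mul1e expeR_ge0.
- move=> t [+ Kt] t0; have Dt := KD _ Kt.
  rewrite /= mul1e (Psig Dt t0) -/(logabs2 _) !lte_fin => gT.
  rewrite /= lee_fin -expRD ler_expR; apply: eg => //.
  exact: polydisc_neg_orthant.
Qed.

(** Near 0 the form exceeds half its value at 0, and e^{-Psi} >= e^{-(T + 1)} on a window; a finite
    norm thus bounds the volume of the windows near 0 by a multiple of e^T. *)
Lemma not_singular_window_measure :
  ~ ohsawa_singular Psi 0 ->
  exists M T0 r : R, [/\ 0 <= M, 0 < r &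
    forall (T : R) (A : set ((n + n).-tuple R)), T < T0 -> measurable A ->
      (forall t, A t -> (forall j, cabs (Cn_point t 0 j) < r) /\
        (T%:E < Psi (Cn_point t) < (T + 1)%:E)%E) ->
      (lebesgueC n A <= (M * expR T)%:E)%E].
Proof.
move=> /existsNP[U /existsNP[f]].
move=> /not_implyP[U0 /not_implyP[UD /not_implyP[cf /not_implyP[f0 /not_implyP[f00]]]]].
move=> /eqP; rewrite -ltey => norm_oo.
have f_gt0 : 0 < f 0 by rewrite lt_def f00 f0//; case: U0.
have [r r0 rU] : exists2 r : R, 0 < r & forall w, (forall j, cabs (w 0 j) < r) ->
    U w /\ f 0 / 2 < f w.
  have : \forall w \near (0 : 'rV[R[i]]_n), U w /\ f 0 / 2 < f w.
    apply: filterI; first exact: open_nbhs_nbhs.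
    have cf0 : f @ (0 : 'rV[R[i]]_n) --> f 0.
      move: cf; rewrite continuous_open_subspace; last by case: U0.
      by apply; rewrite inE; case: U0.
    by apply: (cvgr_gt _ cf0); rewrite ltr_pdivrMr// mulr_natr mulr2n ltrDl.
  move=> /nbhsC_cabs[r r0 rU]; exists r => // w wr; apply: rU => j.
  by rewrite mxE sub0r /cabs normrN; exact: wr.
(* These squares lie in the polydisc of radius r, and contain the one of radius r/4, which is the
   radius given in the conclusion. *)
pose K : set 'rV[R[i]]_n := [set z | forall j,
  `|complex.Re (z 0 j)| <= r / 4 /\ `|complex.Im (z 0 j)| <= r / 4].
have Kr w : K w -> forall j, cabs (w 0 j) < r.
  move=> Kw j; apply: (le_lt_trans (cabs_le_Re_Im _)).
  by have [] := Kw j; lra.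
have KU : K `<=` U by move=> w /Kr/rU[].
have := norm_oo; rewrite /ohsawa_norm; set S := [set _ | _ in _].
have SK : S (limf_esup (fun t : R =>
      integralC ([set z | (t%:E < Psi z < (t + 1)%:E)%E] `&` K)
        (fun z => (f z)%:E * expeR (- Psi z))%E) (ninfty_nbhs R)).
  by exists K => //; split=> //; exact: compact_Re_Im.
move=> /(le_lt_trans (ereal_sup_ubound SK)) /ereal_inf_lt[_ [V [T0 [_ VT0]] <-]] supV.
have [M1 M10 supM] : exists2 M1 : R, 0 <= M1 & forall T, T < T0 ->
    (integralC ([set z | (T%:E < Psi z < (T + 1)%:E)%E] `&` K)
        (fun z => (f z)%:E * expeR (- Psi z))%E <= M1%:E)%E.
  move: supV; set s := ereal_sup _ => soo.
  have h T : T < T0 -> (integralC ([set z | (T%:E < Psi z < (T + 1)%:E)%E] `&` K)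
        (fun z => (f z)%:E * expeR (- Psi z))%E <= s)%E.
    by move=> /VT0 VT; apply: ereal_sup_ubound; exists T.
  move: s soo h => [s| |]// _ h.
    exists `|s| => // T /h hT; apply: (le_trans hT).
    by rewrite lee_fin ler_norm.
  by exists 0 => // T /h hT; apply: (le_trans hT); rewrite leNye.
pose M := M1 / (f 0 / 2) * expR 1.
exists M, T0, (r / 4); split; rewrite ?divr_gt0//.
  by rewrite mulr_ge0 ?expR_ge0// divr_ge0// divr_ge0// ltW.
move=> T A TT0 mA Ar.
have c0 : 0 < f 0 / 2 * expR (- (T + 1)) by rewrite mulr_gt0 ?expR_gt0// divr_gt0.
have AK t : A t -> K (Cn_point t).
  move=> /Ar[tr _] j; split; apply/ltW/(le_lt_trans _ (tr j)).
    exact: Re_le_cabs.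
  exact: Im_le_cabs.
have : ((f 0 / 2 * expR (- (T + 1)))%:E * lebesgueC n A <= M1%:E)%E.
  apply: le_trans (supM T TT0); apply: ge0_integral_ge_cst => //.
  - exact: ltW.
  - move=> t [_ Kt]; rewrite mule_ge0 ?expeR_ge0// lee_fin f0//; exact: KU.
  - move=> t At; have [_ PsiT] := Ar _ At; split; first by split=> //; exact: AK.
    have [_ fw] := rU _ (Kr _ (AK _ At)).
    have [u Pu] : exists u, Psi (Cn_point t) = u%:E.
      move: PsiT; case: (Psi _) => [u _|/andP[_]|/andP[+ _]]; first by exists u.
      - by rewrite ltNge leey.
      - by rewrite ltNge leNye.
    move: PsiT; rewrite Pu !lte_fin => /andP[_ uT]; rewrite -EFinM lee_fin.
    by rewrite ler_pM ?expR_ge0 ?ler_expR ?lerN2 ?divr_ge0// ltW.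
move: (lebesgueC n A) => [a| |]//=.
- rewrite -EFinM !lee_fin; rewrite mulrC -ler_pdivlMr// => h.
  apply: (le_trans h); rewrite /M invfM -expRN opprK expRD.
  by rewrite le_eqVlt; apply/orP; left; apply/eqP; rewrite -!mulrA [expR T * _]mulrC.
- by rewrite gt0_muley ?lte_fin// leye_eq.
- by rewrite leNye.
Qed.

Hypothesis P1 : P (const_mx 1).

Lemma measurable_window (T : R) : measurable
  (@Cn_point R n @^-1` (@polydisc R n `&` [set z | (T%:E < Psi z < (T + 1)%:E)%E])).
Proof.
have [_ Psi_usc _] := Psi_psh.
have mPsi := measurable_fun_usc (@open_polydisc R n) Psi_usc.
have mD := measurable_Cn_point_open (@open_polydisc R n).
rewrite [X in measurable X](_ : _ = @Cn_point R n @^-1` (@polydisc R n) `&`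
    (Psi \o @Cn_point R n) @^-1` `]T%:E, (T + 1)%:E[%classic).
  by apply: mPsi => //; exact: emeasurable_itv.
by apply/seteqP; split => t /=; rewrite in_itv.
Qed.

(** * Packing disjoint boxes into windows *)

Section count.
Variables (M T0 r S : R).
Hypothesis M_ge0 : 0 <= M.
Hypothesis window_le : forall (T : R) (A : set ((n + n).-tuple R)), T < T0 ->
  measurable A ->
  (forall t, A t -> (forall j, cabs (Cn_point t 0 j) < r) /\
        (T%:E < Psi (Cn_point t) < (T + 1)%:E)%E) ->
  (lebesgueC n A <= (M * expR T)%:E)%E.
Hypothesis S_ge0 : 0 <= S.
Hypothesis S_box : forall x t, (forall j, x 0 j <= - S) -> logbox x t ->
  forall j, cabs (Cn_point t 0 j) < r.

(** As (1, .., 1) is in P, [lo s] is a lower bound of g on the boxes shifted by -S. The number [W]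
    of unit windows, placed at steps 1/2, suffices to cover the range from [lo s] to -s + 1 + C. *)
Let lo (s : R) := - s - n%:R * S - 7 * n%:R - C.
Let W := (Num.truncn (2 * (n%:R * S + 7 * n%:R + 2 * C + 1))).+1.

(** The N disjoint boxes have volume proportional to e^{-s} each, and they are covered by [W]
    windows of volume O(e^{-s}); the factor cancels, which bounds N uniformly in s. *)
Lemma logbox_count : exists2 K : R, 0 <= K &
  forall (s : R) (N : nat) (x : nat -> 'rV[R]_n),
  - s + 2 + C < T0 ->
  (forall k, (k < N)%N -> forall j, x k 0 j <= 0) ->
  (forall k, (k < N)%N -> \sum_j x k 0 j = - s) ->
  (forall k, (k < N)%N -> forall p, P p -> dot p (x k) <= - s + 1) ->
  (forall k l, (k < N)%N -> (l < N)%N -> k != l ->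
     exists j, 7 <= `|x k 0 j - x l 0 j|) ->
  N%:R <= K.
Proof.
exists (W%:R * M * expR (2 + C + n%:R * S) * 16 ^+ n).
  by rewrite !mulr_ge0// expR_ge0.
move=> s N x sT0 x0 xs xP xdisj.
pose x' k := x k + const_mx (- S).
pose F k := if (k < N)%N then logbox (x' k) else set0.
have mF k : measurable (F k) by rewrite /F; case: ifP => // _; exact: measurable_logbox.
have tF : trivIset setT F.
  apply/trivIsetP => k l _ _ kl; rewrite /F.
  case: ltnP => [kN|_]; last by rewrite set0I.
  case: ltnP => [lN|_]; last by rewrite setI0.
  have [j] := xdisj k l kN lN kl.
  have [h|h] := leP 0 (x k 0 j - x l 0 j).
    rewrite ger0_norm// setIC => kl7; apply: (@logbox_disjoint R n _ _ j).
    by rewrite !mxE; lra.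
  rewrite ltr0_norm// => kl7; apply: (@logbox_disjoint R n _ _ j).
  by rewrite !mxE; lra.
have xS k : (k < N)%N -> forall j, x' k 0 j <= - S.
  by move=> kN j; rewrite !mxE gerDr x0.
have x'0 k : (k < N)%N -> forall j, x' k 0 j <= 0.
  by move=> kN j; apply: (le_trans (xS k kN j)); rewrite oppr_le0.
have sx' k : (k < N)%N -> \sum_j x' k 0 j = - s - n%:R * S.
  move=> kN; under eq_bigr do rewrite !mxE.
  by rewrite big_split/= xs// sumr_const card_ord mulNrn mulr_natl.
pose B := \big[setU/set0]_(k < N) F k.
have muB : lebesgueC n B = (N%:R * (expR (- s - n%:R * S) / 16 ^+ n))%:E.
  rewrite measure_bigsetU//.
  rewrite (eq_bigr (fun=> (expR (- s - n%:R * S) / 16 ^+ n)%:E)); last first.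
    move=> k _; rewrite /F ltn_ord; apply: (etrans (logbox_measure _)).
    by rewrite sx'.
  by rewrite sumEFin sumr_const card_ord; congr EFin; rewrite -[LHS]mulr_natl.
have mB : measurable B by exact: bigsetU_measurable.
have BP t : B t -> exists2 k, (k < N)%N & logbox (x' k) t.
  by rewrite /B -bigcup_mkord => -[k /= kN]; rewrite /F kN; exists k.
have B_g t : B t -> [/\ Psi (Cn_point t) = (g (logabs2 (Cn_point t)))%:E,
    polydisc (Cn_point t), forall j, cabs (Cn_point t 0 j) < r &
    lo s <= g (logabs2 (Cn_point t)) <= - s + 1 + C].
  move=> /BP[k kN xt]; split.
  - exact: Psi_logbox (x'0 k kN) _.
  - exact: logbox_polydisc (x'0 k kN) xt.
  - exact: S_box (xS k kN) xt.
  - apply/andP; split.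
      have := g_ge (logbox_neg_orthant (x'0 k kN) xt) P1.
      by have := dot1_logbox_ge xt; rewrite sx'// /lo; lra.
    apply: (g_logbox_le (x'0 k kN) xt) => p Pp.
    rewrite dotDr -[leRHS]addr0 lerD// ?xP//.
    by apply: sumr_le0 => j _; rewrite mxE mulr_ge0_le0 ?oppr_le0// P_ge0.
pose T i : R := lo s - 1 / 2 + i%:R / 2.
pose win i := B `&` (@Cn_point R n @^-1`
  (@polydisc R n `&` [set z | ((T i)%:E < Psi z < (T i + 1)%:E)%E])).
have mwin i : measurable (win i) by apply: measurableI => //; exact: measurable_window.
have cover : B `<=` \big[setU/set0]_(i < W) win i.
  move=> t Bt; have [Psit Dt _ /andP[g1 g2]] := B_g t Bt.
  rewrite -bigcup_mkord.
  pose v := 2 * (g (logabs2 (Cn_point t)) - lo s).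
  have v0 : 0 <= v by rewrite mulr_ge0// subr_ge0.
  have /andP[v1 v2] := truncn_itv v0.
  (* The index floor(2 (g - lo s)) places g in the open window from T i to T i + 1; the offset -1/2
     in T i makes the left inequality strict. *)
  exists (Num.truncn v).
    rewrite /= ltnS; apply: le_truncn; rewrite ler_wpM2l//.
    by move: g2; rewrite /lo; lra.
  split=> //; split=> //=; rewrite Psit !lte_fin.
  move: v1 v2; rewrite -natr1 /v /T; move: (Num.truncn _)%:R => q q1 q2.
  by apply/andP; split; lra.
have TW i : (i < W)%N -> T i <= - s + 3 / 2 + C.
  rewrite ltnS => iW; rewrite /T.
  have : i%:R <= 2 * (n%:R * S + 7 * n%:R + 2 * C + 1).
    rewrite -truncn_ge_nat//.
    have := C0; have := ler0n R n; have := S_ge0 => *.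
    by rewrite mulr_ge0// !addr_ge0 ?mulr_ge0.
  by rewrite /lo; lra.
have winle i : (i < W)%N -> (lebesgueC n (win i) <= (M * expR (- s + 2 + C))%:E)%E.
  move=> iW; have Ti := TW i iW.
  apply: (le_trans (window_le (T := T i) (A := win i) _ _ _)) => //.
  - by move: sT0; lra.
  - by move=> t [/B_g[_ _ tr _] [_ tT]].
  - by rewrite lee_fin ler_wpM2l// ler_expR; lra.
have : (lebesgueC n B <= (W%:R * (M * expR (- s + 2 + C)))%:E)%E.
  apply: (@le_trans _ _ (lebesgueC n (\big[setU/set0]_(i < W) win i))).
    apply: le_measure => //; first exact/mem_set.
    by apply/mem_set; apply: bigsetU_measurable => i _; exact: mwin.
  apply: (le_trans (Boole_inequality _ _)); first by move=> i _; exact: mwin.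
  apply: (@le_trans _ _ (\sum_(i < W) (M * expR (- s + 2 + C))%:E)%E).
    by apply: lee_sum => i _; exact: winle.
  by rewrite sumEFin sumr_const card_ord -[_ *+ W]mulr_natl.
rewrite muB lee_fin mulrA ler_pdivrMr ?exprn_gt0//.
have -> : expR (- s + 2 + C) = expR (2 + C + n%:R * S) * expR (- s - n%:R * S).
  by rewrite -expRD; congr expR; ring.
move=> h; rewrite -(ler_pM2r (expR_gt0 (- s - n%:R * S))); apply: (le_trans h).
by rewrite le_eqVlt; apply/orP; left; apply/eqP; ring.
Qed.

End count.

(** * Transverse bound and polarity *)

Variable alpha : 'rV[R]_n.
Hypothesis alpha_ge0 : forall j, 0 <= alpha 0 j.
Hypothesis alpha_sum1 : \sum_j alpha 0 j = 1.
Hypothesis alphaP : forall p, P p -> 1 <= dot p alpha.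

(* By convexity the strip between the ray of - alpha and its translate through e
   stays in {h_P <= 1 . x + 1}; far away, its section contains about |w_j| / 7
   points with disjoint logboxes. *)
Lemma polar_transverse_bound : ~ ohsawa_singular Psi 0 ->
  exists2 M2 : R, 0 <= M2 & forall e : 'rV[R]_n, (forall j, e 0 j <= 0) ->
    (forall p, P p -> dot p e <= \sum_j e 0 j + 1) ->
    forall j, `|e 0 j - (\sum_i e 0 i) * alpha 0 j| <= M2.
Proof.
move=> /not_singular_window_measure[M [T0 [r [M0 r0 win]]]].
have [S S0 Sbox] := @small_logbox R n _ r0.
have [M3 M30 count] :=
  logbox_count M0 win S0 Sbox.
exists (7 * (M3 + 1)); first by rewrite mulr_ge0// addr_ge0.
move=> e e0 eP j.
pose u := \sum_i e 0 i; pose v := e - u *: alpha.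
have -> : e 0 j - u * alpha 0 j = v 0 j by rewrite !mxE.
pose N := Num.truncn (`|v 0 j| / 7).
have v7 : 0 <= `|v 0 j| / 7 by rewrite divr_ge0.
have /andP[N1 N2] := truncn_itv v7; rewrite -/N in N1 N2.
suff NM : N%:R <= M3.
  rewrite mulrC -ler_pdivrMr//; apply/ltW/(lt_le_trans N2).
  by rewrite -natr1 lerD2r.
(* So large that s + u >= 0 and that the windows used lie below T0. *)
pose s := `|u| + `|2 + C - T0| + 1.
have su : 0 <= s + u.
  by have := ler_norm (- u); rewrite normrN /s; have := normr_ge0 (2 + C - T0); lra.
have s0 : 0 <= s by rewrite !addr_ge0.
(* Equally spaced points on the segment from -s alpha to e - (s + u) alpha; v has coordinate sum 0,
   so they all have coordinate sum -s. *)
pose x k := (- s) *: alpha + (k%:R / N%:R) *: v.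
have sumv : \sum_i v 0 i = 0.
  under eq_bigr do rewrite !mxE.
  by rewrite sumrB -mulr_sumr alpha_sum1 mulr1 subrr.
have kN01 (k : nat) : (k < N)%N -> 0 <= k%:R / N%:R :> R /\ k%:R / N%:R <= 1 :> R.
  move=> kN; have N0 : 0 < N%:R :> R by rewrite ltr0n (leq_ltn_trans _ kN).
  by rewrite divr_ge0//= ler_pdivrMr// mul1r ler_nat ltnW.
have xE k i : x k 0 i = (1 - k%:R / N%:R) * (- s * alpha 0 i) +
    k%:R / N%:R * (e 0 i - (s + u) * alpha 0 i).
  by rewrite !mxE; ring.
apply: (count s N x).
- by rewrite /s; have := ler_norm (2 + C - T0); have := normr_ge0 u; lra.
- move=> k /kN01[k0 k1] i; rewrite xE.
  rewrite -[leRHS]addr0 lerD// mulr_ge0_le0 ?subr_ge0// ?mulNr ?oppr_le0 ?mulr_ge0//.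
  by rewrite subr_le0 (le_trans (e0 i))// mulr_ge0.
- move=> k kN; under eq_bigr do rewrite mxE [X in X + _]mxE [X in _ + X]mxE.
  by rewrite big_split/= -!mulr_sumr alpha_sum1 sumv mulr0 addr0 mulr1.
(* At the two ends of the segment p . x is at most -s and -s + 1, because p . alpha >= 1; hence it
   is at most -s + 1 in between. *)
- move=> k /kN01[]; move: (k%:R / N%:R) (xE k) => l xEl l0 l1 p Pp.
  have -> : dot p (x k) = (1 - l) * (- s * dot p alpha) +
      l * (dot p e - (s + u) * dot p alpha).
    rewrite /dot !mulr_sumr -sumrB !mulr_sumr -big_split/=.
    by apply: eq_bigr => i _; rewrite xEl; ring.
  have pa := alphaP Pp; have pe := eP p Pp; rewrite -/u in pe.
  have h1 : - s * dot p alpha <= - s by rewrite mulNr lerN2 ler_peMr.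
  have h2 : dot p e - (s + u) * dot p alpha <= 1 - s.
    by have : s + u <= (s + u) * dot p alpha by [rewrite ler_peMr]; lra.
  have h3 := ler_wpM2l l0 h2.
  have l1' : 0 <= 1 - l by rewrite subr_ge0.
  have h4 := ler_wpM2l l1' h1.
  by apply: (le_trans (lerD h4 h3)); lra.
- move=> k l kN lN kl; exists j.
  have N0 : 0 < N%:R :> R by rewrite ltr0n (leq_ltn_trans _ kN).
  have -> : x k 0 j - x l 0 j = (k%:R - l%:R) * (v 0 j / N%:R).
    by rewrite /x mxE [X in X + _ - _]mxE [X in _ + X - _]mxE
      [X in _ - X]mxE [X in _ - (X + _)]mxE [X in _ - (_ + X)]mxE; ring.
  (* From N <= |v_j|/7, consecutive points differ by at least 7 in coordinate j. *)
  have h7 : 7 <= `|v 0 j| / N%:R by rewrite ler_pdivlMr// mulrC -ler_pdivlMr.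
  rewrite normrM normf_div (gtr0_norm N0).
  have kl1 : 1 <= `|k%:R - l%:R| :> R.
    have [h|h|h] := ltngtP k l; last by rewrite h eqxx in kl.
      by rewrite distrC -natrB ?(ltnW h)// normr_nat ler1n subn_gt0.
    by rewrite -natrB ?(ltnW h)// normr_nat ler1n subn_gt0.
  by apply: (le_trans h7); rewrite ler_peMl// divr_ge0// ltW.
Qed.

(** One inclusion is the supporting hyperplane. For the other, a point (1, .., 1) + q of the
    half-ball outside P would give, by separation, a vector e with p . e <= sum e + 1 on P and q . e
    > 1, while the transverse bound forces q . e <= 1 for small q. *)
Lemma not_singular_locally_hyperplane1 :
  ~ ohsawa_singular Psi 0 -> locally_hyperplane1 P.
Proof.
move=> /polar_transverse_bound[M2 M20 M2P].
pose r := (n%:R * M2 + 1)^-1.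
have r0 : 0 < r by rewrite invr_gt0 ltr_wpDl// mulr_ge0.
exists r; split=> //; exists alpha; split=> //.
apply/seteqP; split=> x /= [] => [xr ax|Px xr]; last first.
  split=> //; have := alphaP Px; rewrite dotC -[leLHS]alpha_sum1 -subr_ge0.
  rewrite /dot -sumrB; congr (_ <= _); apply: eq_bigr => j _; ring.
split=> //; apply: contrapT => nPx.
have [|y [b [y0 yb bx]]] := newton_separation Pn _ nPx; first by exists (const_mx 1).
pose q := x - const_mx 1.
have qE j : q 0 j = x 0 j - 1 by rewrite !mxE.
have xq : x = const_mx 1 + q by rewrite addrC subrK.
pose s := \sum_j y 0 j; pose h := b - s; pose c := dot q y.
have h0 : 0 <= h by rewrite subr_ge0 /s -dot1 yb.
have hc : h < c by move: bx; rewrite xq dotDl dot1 -/s -/c /h; lra.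
have hc0 : 0 < h + c by lra.
(* As 0 <= h < c, this scaling gives l h < 1 < l c. *)
pose l := 2 / (h + c).
have l0 : 0 < l by rewrite divr_gt0.
pose e := l *: y.
have se : \sum_j e 0 j = l * s.
  by rewrite mulr_sumr; apply: eq_bigr => j _; rewrite mxE.
have lh : l * h <= 1 by rewrite /l mulrAC ler_pdivrMr//; lra.
have e0 j : e 0 j <= 0 by rewrite mxE mulr_ge0_le0// ltW.
have eP p : P p -> dot p e <= \sum_j e 0 j + 1.
  move=> Pp; rewrite dotZr se; apply: (@le_trans _ _ (l * b)).
    by rewrite ler_wpM2l ?(ltW l0)// yb.
  have -> : b = s + h by rewrite /h addrC subrK.
  by rewrite mulrDr lerD2l.
have qr j : `|q 0 j| <= r.
  rewrite -ler_sqr ?nnegrE ?(ltW r0)// real_normK ?num_real//.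
  apply: le_trans (ltW xr); rewrite (bigD1 j)//= qE lerDl.
  by apply: sumr_ge0 => i _; exact: sqr_ge0.
have : 1 < dot q e.
  by rewrite dotZr -/c /l mulrAC ltr_pdivlMr//; lra.
apply/negP; rewrite -leNgt.
(* The component (sum e) alpha pairs with q to a nonpositive number, since sum e <= 0 <= q . alpha;
   the transverse part contributes at most n r M2 <= 1 by the choice of r. *)
have -> : dot q e = (l * s) * dot q alpha +
    \sum_j q 0 j * (e 0 j - (\sum_i e 0 i) * alpha 0 j).
  rewrite se /dot mulr_sumr -big_split/=; apply: eq_bigr => j _; ring.
have h1 : (l * s) * dot q alpha <= 0.
  apply: mulr_le0_ge0.
    by rewrite -se; apply: sumr_le0 => j _.
  rewrite dotC; apply: le_trans ax _; rewrite le_eqVlt; apply/orP; left.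
  by apply/eqP; apply: eq_bigr => j _; rewrite qE.
have h2 : \sum_j q 0 j * (e 0 j - (\sum_i e 0 i) * alpha 0 j) <= n%:R * (r * M2).
  rewrite mulr_natl -[X in _ *+ X](card_ord n) -sumr_const.
  apply: ler_sum => j _; apply: (le_trans (ler_norm _)).
  by rewrite normrM ler_pM// M2P.
have h3 : n%:R * (r * M2) <= 1.
  rewrite mulrCA /r mulrC ler_pdivrMr ?mul1r ?lerDl//.
  by rewrite ltr_wpDl// mulr_ge0.
lra.
Qed.

End toric_ohsawa_norm.

Theorem theorem1p5 (R : realType) (n : nat) (hn : (1 <= n)%N)
    (Psi : 'rV[R[i]]_n -> \bar R) (P : set 'rV[R]_n)
    (Psi_psh : psh_on (@polydisc R n) Psi) (Psi_toric : toric Psi)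
    (Psi_isolated : isolated_singularity0 Psi)
    (Psi_lct : lct0 Psi = 1%E)
    (P_newton : newton_body_of Psi P) :
  boundary P (const_mx 1) /\
  (~ ohsawa_singular Psi 0 <-> locally_hyperplane1 P).
Proof.
have [Pn P0 [g [C [C0 Psig g_ge g_le]]]] := newton_body_bounds P_newton.
have P1 := lct0_newton_mem1 Pn P0 Psig g_le Psi_lct.
have nP1 := lct0_newton_nbhs1 hn Psi_psh Pn Psig g_ge Psi_lct.
have [alpha [alpha0 alpha1 alphaP]] := newton_supporting_hyperplane1 Pn P1 nP1.
split; first by split=> //; exact: subset_closure.
split.
  exact: (not_singular_locally_hyperplane1 Psi_psh Pn C0 Psig g_ge g_le P1
    alpha0 alpha1 alphaP).
exact: (locally_hyperplane1_not_singular hn C0 Psig g_ge).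
Qed.
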